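(* All the coefficients of the series $\delta(\mathcal B(z))$ (the quantum contraction of $\mathcal B(z)$), defined by $$Q_{12}\,\bar{\mathcal B}_1(z)\,\bar R_{21}(z^2\rho)\,\mathcal B_2(z\rho)\,V_1V_2=\mathcal B_2(z\rho)\,\bar R_{12}(z^2\rho)\,\bar{\mathcal B}_1(z)\,V_1V_2\,Q_{12}=Q_{12}\,\delta(\mathcal B(z)),$$ belong to the center of the reflection algebra.
   Context: $\mathcal N\ge2$, $q$ is a nonzero complex deformation parameter with $q^2\ne1$ (with fixed fractional powers), $\rho=q^{\mathcal N/2}$, $E_{ab}$ are elementary matrices, $t_1,t_2$ are transpositions in the first, second factor, and $$R_{12}(z)=\mathfrak a(z)\sum_{a}E_{aa}\otimes E_{aa}+\mathfrak b(z)\sum_{a\ne b}E_{aa}\otimes E_{bb}+(q-q^{-1})\sum_{a\neq b}z^{\mathrm{sgn}(b-a)}E_{ab}\otimes E_{ba},$$ $\mathfrak a(z)=qz-q^{-1}z^{-1}$, $\mathfrak b(z)=z-z^{-1}$. With $\bar a=\mathcal N+1-a$, $V=\sum V_{ab}E_{ab}$ is given either by $V_{ab}=q^{(a-b)/2}\delta_{b,\bar a}$ or (only for $\mathcal N$ even) $V_{ab}=i(-1)^aq^{(a-b)/2}\delta_{b,\bar a}$; $V^2=\mathbb I$. Put $\bar R_{12}(z)=V_1R_{12}^{t_2}(z^{-1}\rho^{-1})V_1$; $R_{21},\bar R_{21}$ are obtained by exchanging the tensor factors. $Q_{12}=\frac1{\mathcal N}V_1\mathcal P_{12}^{t_2}V_1$,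 with $\mathcal P_{12}=\sum_{a,b}E_{ab}\otimes E_{ba}$, is a projector of rank one, and $\bar R_{12}(\rho^{-1})=(q-q^{-1})\mathcal N Q_{12}$. $\mathcal U_q(\widehat{gl}(\mathcal N))$ at $c=0$ is generated by the coefficients of $\mathcal L^{\pm}(z)=\sum_{n\ge0}\sum_{a,b}z^{\pm2n}E_{ab}\otimes L_{ab}^{(\pm n)}$ with $R_{12}(\frac zw)\mathcal L_1^{\pm}(z)\mathcal L_2^{\pm}(w)=\mathcal L_2^{\pm}(w)\mathcal L_1^{\pm}(z)R_{12}(\frac zw)$, $R_{12}(\frac zw)\mathcal L_1^{+}(z)\mathcal L_2^{-}(w)=\mathcal L_2^{-}(w)\mathcal L_1^{+}(z)R_{12}(\frac zw)$, $L^{(+0)}_{ab}=L^{(-0)}_{ba}=0$ for $a<b$, $L^{(+0)}_{aa}L^{(-0)}_{aa}=L^{(-0)}_{aa}L^{(+0)}_{aa}=1$. Let $\mathcal T^\pm(z)=\mathcal L^\pm_{01}(z)\cdots\mathcal L^\pm_{0N}(z)$ ($N\ge1$ copies of the algebra) and $\widehat{\mathcal T}^{\pm}(z)=V\big(\mathcal T^{\pm}(z\rho)^{-1}\big)^{t}V$, where $t$ is transposition in the auxiliary space. $K(z)$ and $\bar K(z)$ are $\mathbb C$-valued matrices, each satisfying the reflection equation $R_{12}(\frac zw)K_1(z)R_{21}(zw)K_2(w)=K_2(w)R_{12}(zw)K_1(z)R_{21}(\frac zw)$ and related by $$\bar R_{12}(\tfrac zw)\bar K_1(z)\bar R_{21}(zw)K_2(w)=K_2(w)\bar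 R_{12}(zw)\bar K_1(z)\bar R_{21}(\tfrac zw).\qquad( * )$$ Set $$\mathcal B(z)=\mathcal T^+(z)K(z)\mathcal T^-(z^{-1})^{-1},\qquad\bar{\mathcal B}(z)=\widehat{\mathcal T}^+(z)\,\bar K(z)\,V^t\,\mathcal T^-(z^{-1}\rho^{-1})^t\,V^t .$$ Both satisfy the reflection equation, and together they satisfy $( * )$ with $\bar K,K$ replaced by $\bar{\mathcal B},\mathcal B$; taking $w=z\rho$ in $( * )$ and multiplying on the right by $V_1V_2$ gives the first equality in the definition of $\delta(\mathcal B(z))$, and since $Q_{12}$ has rank one this defines the series $\delta(\mathcal B(z))$ with coefficients in the quantum algebra. The reflection algebra is the algebra generated by the coefficients of the entries of $\mathcal B(w)$; belonging to its center means in particular commuting with all these coefficients. *)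

(* Defs.v *)
From HB Require Import structures.
From mathcomp Require Import all_boot all_order all_algebra.
From mathcomp Require Import mxtens complex.
From mathcomp Require Import boolp classical_sets functions cardinality fsbigop.
From mathcomp Require Import reals.

Set Implicit Arguments.
Unset Strict Implicit.
Unset Printing Implicit Defensive.

Import Order.TTheory GRing.Theory Num.Theory.
Local Open Scope classical_set_scope.
Local Open Scope ring_scope.

(* A formal series with matrix coefficients is its coefficient function
   G -> 'M_n, where G is the group of exponents: G = int for series in z, and
   G = int * int for series in z and w, (i, j) standing for z^i w^j. *)

(* Cauchy product. The sum over h ranges over its support if that is finite and
   is 0 otherwise; in every product formed below it is finite. *)
Definition smul (S : pzRingType) (G : zmodType) (n : nat)
    (X Y : G -> 'M[S]_n) : G -> 'M[S]_n :=
  fun g => \sum_(h \in [set: G]) X h *m Y (g - h).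

Notation "X ** Y" := (smul X Y) (at level 40, left associativity) : ring_scope.

Definition cst (S : pzRingType) (G : zmodType) (n : nat)
    (M : 'M[S]_n) : G -> 'M[S]_n :=
  fun g => if g == 0 then M else 0.

(* [subst c e X] is X(c u^e), u^e being the monomial with exponent e; for e of
   infinite order, the only case used, the sum has at most one term. *)
Definition subst (C : fieldType) (A : lmodType C) (G : zmodType) (n : nat)
    (c : C) (e : G) (X : int -> 'M[A]_n) : G -> 'M[A]_n :=
  fun g => \matrix_(i, j) \sum_(k \in [set k : int | e *~ k = g]) c ^ k *: X k i j.

Definition laurent (S : pzRingType) (n : nat) (X : int -> 'M[S]_n) : Prop :=
  exists m : int, forall k : int, k < m -> X k = 0.

Definition is_sinv (S : pzRingType) (n : nat) (X Y : int -> 'M[S]_n) : Prop :=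
  [/\ laurent Y, X ** Y = cst 1%:M & Y ** X = cst 1%:M].

(* The inverse in the ring of Laurent series (X itself if there is none). *)
Definition sinv (S : pzRingType) (n : nat) (X : int -> 'M[S]_n) :
    int -> 'M[S]_n :=
  xget X [set Y | is_sinv X Y].

Definition str (S : pzRingType) (G : zmodType) (n : nat) (X : G -> 'M[S]_n) :
    G -> 'M[S]_n := fun g => (X g)^T.

Definition emb (C : fieldType) (A : algType C) (G : Type) (n : nat)
    (X : G -> 'M[C]_n) : G -> 'M[A]_n :=
  fun g => map_mx (in_alg A) (X g).

Definition mx1 (S : pzRingType) (N : nat) (X : 'M[S]_N) : 'M[S]_(N * N) :=
  tensmx X 1%:M.
Definition mx2 (S : pzRingType) (N : nat) (X : 'M[S]_N) : 'M[S]_(N * N) :=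
  tensmx 1%:M X.

Definition sp1 (S : pzRingType) (G : Type) (N : nat) (X : G -> 'M[S]_N) :
    G -> 'M[S]_(N * N) := fun g => mx1 (X g).
Definition sp2 (S : pzRingType) (G : Type) (N : nat) (X : G -> 'M[S]_N) :
    G -> 'M[S]_(N * N) := fun g => mx2 (X g).

Definition trmx2 (S : pzRingType) (N : nat) (M : 'M[S]_(N * N)) :
    'M[S]_(N * N) :=
  \matrix_(i, j)
    let: (i1, i2) := mxtens_unindex i in
    let: (j1, j2) := mxtens_unindex j in
    M (mxtens_index (i1, j2)) (mxtens_index (j1, i2)).

Definition Pmx (S : pzRingType) (N : nat) : 'M[S]_(N * N) :=
  \sum_(a < N) \sum_(b < N) tensmx (delta_mx a b) (delta_mx b a).

(* X_12 |-> X_21 *)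
Definition swap (S : pzRingType) (N : nat) (X : int -> 'M[S]_(N * N)) :
    int -> 'M[S]_(N * N) :=
  fun k => Pmx S N *m X k *m Pmx S N.

Definition acoef (C : fieldType) (q : C) (k : int) : C :=
  (k == 1)%:R * q - (k == -1)%:R * q^-1.

Definition bcoef (C : fieldType) (k : int) : C :=
  (k == 1)%:R - (k == -1)%:R.

Definition Rser (C : fieldType) (N : nat) (q : C) : int -> 'M[C]_(N * N) :=
  fun k =>
    acoef q k *: (\sum_(a < N) tensmx (delta_mx a a) (delta_mx a a))
    + bcoef C k *:
        (\sum_(a < N) \sum_(b < N | a != b) tensmx (delta_mx a a) (delta_mx b b))
    + (q - q^-1) *:
        (\sum_(a < N) \sum_(b < N | a != b)
           (k == sgz (b%:Z - a%:Z))%:R *: tensmx (delta_mx a b) (delta_mx b a)).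

(* s is the chosen square root of q. Ordinals are the indices shifted by -1:
   only (-1)^a is sensitive to the shift, and N + 1 - a is [rev_ord a]. *)
Definition V_plus (C : fieldType) (N : nat) (s : C) : 'M[C]_N :=
  \matrix_(a, b) if b == rev_ord a then s ^ (a%:Z - b%:Z) else 0.

Definition V_minus (R : realType) (N : nat) (s : R[i]) : 'M[R[i]]_N :=
  \matrix_(a, b)
    if b == rev_ord a then 'i%C * (-1) ^+ a.+1 * s ^ (a%:Z - b%:Z) else 0.

Definition Rbar (C : fieldType) (N : nat) (q rho : C) (V : 'M[C]_N) :
    int -> 'M[C]_(N * N) :=
  fun k => mx1 V *m
    trmx2 (subst (A := C^o) rho^-1 (-1 : int) (Rser N q) k) *m mx1 V.

Definition Qmx (C : fieldType) (N : nat) (V : 'M[C]_N) : 'M[C]_(N * N) :=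
  N%:R^-1 *: (mx1 V *m trmx2 (Pmx C N) *m mx1 V).

(* r(z/w) X_1(z) r_21(zw) Y_2(w) = Y_2(w) r(zw) X_1(z) r_21(z/w) *)
Definition refl_eq (C : fieldType) (N : nat) (r : int -> 'M[C]_(N * N))
    (X Y : int -> 'M[C]_N) : Prop :=
  let z : int * int := (1, 0) in
  let w : int * int := (0, 1) in
  let at_ n e F := subst (A := C^o) (n := n) 1 e F in
  at_ _ (z - w) r ** sp1 (at_ _ z X) ** at_ _ (z + w) (swap r) ** sp2 (at_ _ w Y)
  = sp2 (at_ _ w Y) ** at_ _ (z + w) r ** sp1 (at_ _ z X) ** at_ _ (z - w) (swap r).

(* R(z/w) X_1(z) Y_2(w) = Y_2(w) X_1(z) R(z/w) *)
Definition RLL (C : fieldType) (A : algType C) (N : nat) (q : C)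
    (X Y : int -> 'M[A]_N) : Prop :=
  let z : int * int := (1, 0) in
  let w : int * int := (0, 1) in
  let Rzw := emb A (subst (A := C^o) 1 (z - w) (Rser N q)) in
  let X1 := sp1 (subst 1 z X) in
  let Y2 := sp2 (subst 1 w Y) in
  Rzw ** X1 ** Y2 = Y2 ** X1 ** Rzw.

(* sum_n z^(2 eps n) L_n *)
Definition Lser (A : pzRingType) (N : nat) (eps : int) (L : nat -> 'M[A]_N) :
    int -> 'M[A]_N :=
  fun k => \sum_(n \in [set n : nat | k = eps * (2 * n)%N%:Z]) L n.

(* The defining relations of U_q(gl^(N)) at c = 0. *)
Definition Uq_relations (C : fieldType) (A : algType C) (N : nat) (q : C)
    (Lp Lm : nat -> 'M[A]_N) : Prop :=
  [/\ RLL q (Lser 1 Lp) (Lser 1 Lp),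
      RLL q (Lser (-1) Lm) (Lser (-1) Lm),
      RLL q (Lser 1 Lp) (Lser (-1) Lm),
      (forall a b : 'I_N, (a < b)%N -> Lp 0%N a b = 0 /\ Lm 0%N b a = 0)
    & (forall a : 'I_N, Lp 0%N a a * Lm 0%N a a = 1
                        /\ Lm 0%N a a * Lp 0%N a a = 1)].

Definition comm_entries (A : pzRingType) (N : nat) (X Y : 'M[A]_N) : Prop :=
  forall a b c d, GRing.comm (X a b) (Y c d).

(* m mutually commuting families, each satisfying the relations of U_q: this is
   the same thing as an algebra morphism from U_q^{(x) m} to A. *)
Definition Uq_copies (C : fieldType) (A : algType C) (N m : nat) (q : C)
    (Lp Lm : 'I_m -> nat -> 'M[A]_N) : Prop :=
  (forall i, Uq_relations q (Lp i) (Lm i)) /\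
  (forall i j, i != j -> forall n p,
     [/\ comm_entries (Lp i n) (Lp j p),
         comm_entries (Lp i n) (Lm j p)
       & comm_entries (Lm i n) (Lm j p)]).

Definition Tser (A : pzRingType) (N m : nat) (eps : int)
    (L : 'I_m -> nat -> 'M[A]_N) : int -> 'M[A]_N :=
  \big[@smul A int N/cst 1%:M]_(i < m) Lser eps (L i).

Definition That (C : fieldType) (A : algType C) (N : nat) (rho : C)
    (V : 'M[C]_N) (Tp : int -> 'M[A]_N) : int -> 'M[A]_N :=
  let VA := emb A (cst V) in
  VA ** str (sinv (subst rho (1 : int) Tp)) ** VA.

Definition Bser (C : fieldType) (A : algType C) (N : nat)
    (K : int -> 'M[C]_N) (Tp Tm : int -> 'M[A]_N) : int -> 'M[A]_N :=
  Tp ** emb A K ** sinv (subst 1 (-1 : int) Tm).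

Definition Bbar (C : fieldType) (A : algType C) (N : nat) (rho : C)
    (V : 'M[C]_N) (Kb : int -> 'M[C]_N) (Tp Tm : int -> 'M[A]_N) :
    int -> 'M[A]_N :=
  let Vt := emb A (cst V^T) in
  That rho V Tp ** emb A Kb ** Vt ** str (subst rho^-1 (-1 : int) Tm) ** Vt.

(* d is the series delta(B(z)) of the two B's. *)
Definition is_contraction (C : fieldType) (A : algType C) (N : nat) (q rho : C)
    (V : 'M[C]_N) (Bb B : int -> 'M[A]_N) (d : int -> A) : Prop :=
  let Q := emb A (cst (Qmx V)) in
  let VV := emb A (cst (mx1 V *m mx2 V)) in
  let Rb12 := Rbar q rho V in
  let Rb21 := swap Rb12 in
  let at_z2rho r := emb A (subst (A := C^o) rho (2 : int) r) in
  let B2 := sp2 (subst rho (1 : int) B) in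
  let Qd := fun k => d k *: map_mx (in_alg A) (Qmx V) in
  Q ** sp1 Bb ** at_z2rho Rb21 ** B2 ** VV = Qd
  /\ B2 ** at_z2rho Rb12 ** sp1 Bb ** VV ** Q = Qd.

Definition refl_alg (C : fieldType) (A : algType C) (N : nat)
    (B : int -> 'M[A]_N) : set A :=
  smallest [set S : set A | subalg_closed [in S]]
           [set x | exists k a b, x = B k a b].

Definition center (A : pzRingType) (S : set A) : set A :=
  [set x | S x /\ forall y, S y -> GRing.comm x y].

(* Main.v *)
Require Import Defs.
From HB Require Import structures.
From mathcomp Require Import all_boot all_order all_algebra.
From mathcomp Require Import mxtens complex.
From mathcomp Require Import finmap.
From mathcomp Require Import boolp classical_sets functions cardinality fsbigop.
From mathcomp Require Import reals zify ring.
Import Defs.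

(** At c = 0 the contraction is a number: delta(B(z)) = delta(K(z)) 1, where
    delta(K(z)) is the contraction of the scalar pair (K, Kbar), so centrality is
    immediate and only this factorization has to be shown. Put x = z rho and
    M = T^-(x^-1). The RTT relation R(x^2) T^+_1(x) M_2 = M_2 T^+_1(x) R(x^2) and
    the unitarity R_12(u) R_21(u^-1) = a(u) a(u^-1) (a consequence of the Hecke
    relation) give T^+_1 M_2 R_21(x^-2) = R_21(x^-2) M_2 T^+_1. Partial
    transposition and conjugation by V turn it into relations which move
    (V^t M^t V^t)_1 through Rbar_21(z^2 rho) T^+_2, and M_2^-1 through
    Rbar_12(z^2 rho) That^+_1. Since P^{t_2} X_1^t = P^{t_2} X_2, the projector Q
    then absorbs That^+_1 T^+_2 and (V^t M^t V^t)_1 M_2^-1, leaving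
    Q Kbar_1 Rbar_21 K_2 V_1 V_2, and this is a multiple of Q by the mixed
    reflection equation for (Kbar, K) at w = z rho. *)

Set Implicit Arguments.
Unset Strict Implicit.
Unset Printing Implicit Defensive.

Import Order.TTheory GRing.Theory Num.Theory.
Local Open Scope classical_set_scope.
Local Open Scope ring_scope.

(** The obstacle is formal: a Cauchy product whose coefficient has infinitely many nonzero terms
    takes the default value 0, so [smul] is associative only under finiteness conditions. All
    computations are therefore made with Laurent series in z alone, and two-variable relations enter
    only through two specializations. One is w = 1/z in the relation between L^+(z) and L^-(w):
    T^-(1/z) is again a power series in z, and R(z/w) becomes R(z^2). The other is w = rho z for the
    scalar pair, where Rbar(z/w) becomes (q - q^-1) N Q, a factor that can be cancelled because q^2
    differs from 1. The relation is not inverted by dividing by R but by multiplying with R_21(z^-2)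
    on both sides; the scalar q^2 + q^-2 - z^4 - z^-4 that appears is not a zero divisor on Laurent
    series. The absorption of the second pair of factors needs a Q that the word does not contain.
    It comes from the contraction of (Kbar, K), which the two forms of its definition show to be
    unchanged by Q on either side. *)

Section FiniteSums.
Variable V : nmodType.

Lemma fsum_single (I : choiceType) (a : I) (f : I -> V) :
  (forall x, x != a -> f x = 0) -> \sum_(x \in [set: I]) f x = f a.
Proof.
move=> fa; rewrite -(@fsbig_set1 _ 0 +%R _ a f); apply/esym/fsbig_widen => // x [_ /eqP].
exact: fa.
Qed.

(** The two projections of the finite support span a finite rectangle outside which [f] vanishes.
    Finiteness matters because a sum with infinite support is 0 by convention, while the iterated
    sums may be honest sums. *)
Lemma fsum_pair (I J : choiceType) (f : I * J -> V) :
  finite_set (f @^-1` [set~ 0]) ->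
  \sum_(p \in [set: I * J]) f p =
  \sum_(i \in [set: I]) \sum_(j \in [set: J]) f (i, j).
Proof.
set S := _ @^-1` _ => finS.
have finA : finite_set (fst @` S) by exact: finite_image.
have finB : finite_set (snd @` S) by exact: finite_image.
have out i j : (~ (fst @` S) i) \/ (~ (snd @` S) j) -> f (i, j) = 0.
  by case=> ij; apply: contrapT => fij; apply: ij; exists (i, j).
transitivity (\sum_(p \in (fst @` S) `*` (snd @` S)) f (p.1, p.2)).
  under [LHS]eq_fsbigr do rewrite [X in f X]surjective_pairing.
  apply/esym/fsbig_widen => // -[i j] [_ /not_andP]; exact: out.
rewrite -(@pair_fsbig _ 0 +%R _ _ _ _ (fun i j => f (i, j))) //.
transitivity (\sum_(i \in fst @` S) \sum_(j \in [set: J]) f (i, j)).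
  apply: eq_fsbigr => i _; apply: fsbig_widen => // j [_ nj].
  by apply: out; right.
apply: fsbig_widen => // i [_ ni]; apply: fsbig1 => j _.
by apply: out; left.
Qed.

(** [phi] may kill infinitely many terms, so for an infinite support the left side would be the
    default 0 and the right side possibly a genuine sum. *)
Lemma fsum_raddf (U : nmodType) (I : choiceType) (phi : {additive V -> U}) (f : I -> V) :
  finite_set (f @^-1` [set~ 0]) ->
  phi (\sum_(x \in [set: I]) f x) = \sum_(x \in [set: I]) phi (f x).
Proof.
move=> finf.
have outf x : x \notin fset_set (f @^-1` [set~ 0]) -> f x = 0.
  by rewrite in_fset_set// => /negP; rewrite inE => /contrapT.
rewrite (fsbigTE _ _ outf) raddf_sum; apply/esym/fsbigTE => x /outf ->.
exact: raddf0.
Qed.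

End FiniteSums.

Lemma finite_itv_int (a b : int) : finite_set [set k : int | a <= k <= b].
Proof.
apply: (@sub_finite_set _ _ ((fun n : nat => a + n%:Z) @` `I_(`|b - a|%N.+1))).
  move=> k /= /andP[ak kb]; exists `|k - a|%N; last by lia.
  by rewrite /=; lia.
exact/finite_image/finite_II.
Qed.

Lemma finite_int1 (V : nmodType) (f : int -> V) (a b : int) :
  (forall k, f k <> 0 -> a <= k <= b) -> finite_set (f @^-1` [set~ 0]).
Proof. by move=> fab; apply: sub_finite_set (finite_itv_int a b) => k /fab. Qed.

Lemma finite_int2 (V : nmodType) (f : int * int -> V) (a b c d : int) :
  (forall i j, f (i, j) <> 0 -> a <= i <= b /\ c <= j <= d) ->
  finite_set (f @^-1` [set~ 0]).
Proof.
move=> fab; apply: sub_finite_set (finite_setX (finite_itv_int a b) (finite_itv_int c d)).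
by case=> i j /fab.
Qed.

Lemma finite_int3 (V : nmodType) (f : int * (int * int) -> V) (a b c d e g : int) :
  (forall i j k, f (i, (j, k)) <> 0 ->
     [/\ a <= i <= b, c <= j <= d & e <= k <= g]) ->
  finite_set (f @^-1` [set~ 0]).
Proof.
move=> fab; apply: sub_finite_set (finite_setX (finite_itv_int a b)
  (finite_setX (finite_itv_int c d) (finite_itv_int e g))).
by case=> i [j k] /fab[].
Qed.

Lemma mulmx_neq0 (S : pzRingType) m n p (X : 'M[S]_(m, n)) (Y : 'M[S]_(n, p)) :
  X *m Y <> 0 -> X <> 0 /\ Y <> 0.
Proof.
by move=> XY; split=> E; apply: XY; rewrite E ?mul0mx ?mulmx0.
Qed.

Definition mono (S : pzRingType) (G : zmodType) (n : nat) (e : G) (M : 'M[S]_n) :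
  G -> 'M[S]_n := fun g => if g == e then M else 0.

(** * Cauchy products of Laurent series *)

Section Series.
Variables (S : pzRingType) (n : nat).
Implicit Types X Y Z : int -> 'M[S]_n.

Lemma laurentP X : laurent X <-> exists m, forall k, X k <> 0 -> m <= k.
Proof.
split=> -[m Xm]; exists m => k.
  by move=> Xk; rewrite leNgt; apply/negP => /Xm.
by move=> km; apply: contrapT => /Xm; rewrite leNgt km.
Qed.

Lemma mono_smulE (G : zmodType) (e : G) (M : 'M[S]_n) (X : G -> 'M[S]_n) g :
  (mono e M ** X) g = M *m X (g - e).
Proof.
rewrite /smul (@fsum_single _ _ e) /mono ?eqxx// => x /negPf ->.
by rewrite mul0mx.
Qed.

Lemma smul_monoE (G : zmodType) (e : G) (M : 'M[S]_n) (X : G -> 'M[S]_n) g :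
  (X ** mono e M) g = X (g - e) *m M.
Proof.
rewrite /smul (@fsum_single _ _ (g - e)) /mono ?subKr ?eqxx// => x xg.
case: eqP => [E|]; last by rewrite mulmx0.
by rewrite -E subKr eqxx in xg.
Qed.

Lemma cst_smulE (G : zmodType) (M : 'M[S]_n) (X : G -> 'M[S]_n) g :
  (cst M ** X) g = M *m X g.
Proof. by rewrite -[in RHS](subr0 g); exact: (mono_smulE 0 M X g). Qed.

Lemma smul_cstE (G : zmodType) (M : 'M[S]_n) (X : G -> 'M[S]_n) g :
  (X ** cst M) g = X g *m M.
Proof. by rewrite -[in RHS](subr0 g); exact: (smul_monoE 0 M X g). Qed.

Lemma smul1s (G : zmodType) (X : G -> 'M[S]_n) : cst 1%:M ** X = X.
Proof. by apply/funext => g; rewrite cst_smulE mul1mx. Qed.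

Lemma smuls1 (G : zmodType) (X : G -> 'M[S]_n) : X ** cst 1%:M = X.
Proof. by apply/funext => g; rewrite smul_cstE mulmx1. Qed.

Lemma cstM (G : zmodType) (M M' : 'M[S]_n) :
  cst M ** cst M' = cst (M *m M') :> (G -> _).
Proof.
by apply/funext => g; rewrite cst_smulE /cst; case: ifP; rewrite ?mulmx0.
Qed.

Lemma laurent_mono e (M : 'M[S]_n) : laurent (mono e M).
Proof. by exists e => k ke; rewrite /mono lt_eqF. Qed.

Lemma laurent_cst (M : 'M[S]_n) : laurent (cst M).
Proof. exact: (laurent_mono 0). Qed.

Lemma laurent_smul X Y : laurent X -> laurent Y -> laurent (X ** Y).
Proof.
move=> /laurentP[a Xa] /laurentP[b Yb]; exists (a + b) => k kab.
apply: fsbig1 => h _; apply: contrapT => /mulmx_neq0[/Xa ? /Yb ?]; lia.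
Qed.

Lemma finite_smul X Y k : laurent X -> laurent Y ->
  finite_set ((fun h => X h *m Y (k - h)) @^-1` [set~ 0]).
Proof.
move=> /laurentP[a Xa] /laurentP[b Yb].
apply: (@finite_int1 _ _ a (k - b)) => h /mulmx_neq0[/Xa ? /Yb ?]; lia.
Qed.

(** Both bracketings are sums over pairs of exponents. The lower bounds of the three supports leave
    finitely many nonzero pairs, which justifies the passage between iterated and double sums. *)
Lemma smulA X Y Z : laurent X -> laurent Y -> laurent Z ->
  X ** (Y ** Z) = X ** Y ** Z.
Proof.
move=> lX lY lZ; apply/funext => k; rewrite /smul.
have [[a Xa] [b Yb] [c Zc]] :
  [/\ exists m, forall k, X k <> 0 -> m <= k,
      exists m, forall k, Y k <> 0 -> m <= k
    & exists m, forall k, Z k <> 0 -> m <= k] by split; apply/laurentP.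
transitivity (\sum_(h \in [set: int]) \sum_(l \in [set: int])
    X h *m (Y l *m Z (k - h - l))).
  apply: eq_fsbigr => h _; rewrite -[LHS]/(mulmx (X h) _) fsum_raddf//.
  exact: finite_smul.
rewrite -(fsum_pair (f := fun p => X p.1 *m (Y p.2 *m Z (k - p.1 - p.2)))); last first.
  apply: (@finite_int2 _ _ a (k - c - b) b (k - c - a)) => i j /=.
  move=> /mulmx_neq0[/Xa ? /mulmx_neq0[/Yb ? /Zc ?]]; split; lia.
transitivity (\sum_(h \in [set: int]) \sum_(l \in [set: int])
    X l *m (Y (h - l) *m Z (k - h))); last first.
  apply: eq_fsbigr => h _; rewrite -[RHS]/(mulmxr (Z (k - h)) _) fsum_raddf//=.
    by apply: eq_fsbigr => l _; rewrite mulmxA.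
  exact: finite_smul.
rewrite -(fsum_pair (f := fun p => X p.2 *m (Y (p.1 - p.2) *m Z (k - p.1)))); last first.
  apply: (@finite_int2 _ _ (a + b) (k - c) a (k - c - b)) => i j /=.
  move=> /mulmx_neq0[/Xa ? /mulmx_neq0[/Yb ? /Zc ?]]; split; lia.
(* On the right [h] is the total exponent taken from [X] and [Y], and [l] the part taken from
   [X]. *)
rewrite (reindex_fsbigT (fun p : int * int => (p.2, p.1 - p.2))).
  by apply: eq_fsbigr => -[h l] _ /=; rewrite -addrA -opprD subrKC.
exists (fun p => (p.1 + p.2, p.1)) => -[i j] /=; congr pair; lia.
Qed.

End Series.

(** * Substitution and specialization *)

Section Substitution.
Variables (C : fieldType) (A : algType C) (n : nat).
Implicit Types (X Y : int -> 'M[A]_n) (c : C).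

(** Over the noncommutative [A] a matrix is scaled from the left by elements of [A]. Complex
    scalars, written [c%:A], are central and so pass the left factor. *)
Lemma mulmx_algr p m r c (X : 'M[A]_(p, m)) (Y : 'M[A]_(m, r)) :
  X *m (c%:A *: Y) = c%:A *: (X *m Y).
Proof.
apply/matrixP => i j; rewrite !mxE mulr_sumr; apply: eq_bigr => k _.
by rewrite mxE !mulr_algl scalerAr.
Qed.

Lemma scalemx_algM p m (a b : C) (X : 'M[A]_(p, m)) :
  a%:A *: (b%:A *: X) = (a * b)%:A *: X.
Proof. by rewrite scalerA mulr_algl scalerA. Qed.

Lemma scalemx_alg1 p m (X : 'M[A]_(p, m)) : (1 : C)%:A *: X = X.
Proof. by rewrite !scale1r. Qed.

Section General.
Variables (G : zmodType) (e : G) (c : C).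
Hypothesis e_inj : injective (fun k : int => e *~ k).

Lemma subst_on X k : subst c e X (e *~ k) = (c ^ k)%:A *: X k.
Proof.
apply/matrixP => i j; rewrite !mxE mulr_algl.
rewrite (_ : [set k0 | _] = [set k]) ?fsbig_set1//.
by apply/seteqP; split=> l /= => [/e_inj|->].
Qed.

Lemma subst_off X g : (forall k, e *~ k <> g) -> subst c e X g = 0.
Proof.
move=> eg; apply/matrixP => i j; rewrite !mxE.
by apply: fsbig1 => k /= /eg.
Qed.

(** The working criterion for identities between substituted series: compare on the multiples of
    [e], and check vanishing elsewhere. *)
Lemma subst_ext X (F : G -> 'M[A]_n) :
  (forall k, F (e *~ k) = (c ^ k)%:A *: X k) ->
  (forall g, (forall k, e *~ k <> g) -> F g = 0) ->
  F = subst c e X.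
Proof.
move=> F1 F2; apply/funext => g.
have [[k <-]|eg] := pselect (exists k, e *~ k = g); first by rewrite subst_on.
have eg' k : e *~ k <> g by move=> E; apply: eg; exists k.
by rewrite F2 ?subst_off.
Qed.

Lemma subst_neq0 X g : subst c e X g <> 0 -> exists2 k, g = e *~ k & X k <> 0.
Proof.
have [[k <-]|eg] := pselect (exists k, e *~ k = g).
  by rewrite subst_on => Xk; exists k => // E; rewrite E scaler0 in Xk.
by rewrite subst_off // => k E; apply: eg; exists k.
Qed.

End General.

Lemma mulrz_intI (e : int) : e != 0 -> injective (fun k : int => e *~ k).
Proof. by move=> e0 k l /=; rewrite !mulrzz => /(mulfI e0). Qed.

Lemma pair_mulrz (a b k : int) : ((a, b) : int * int) *~ k = (a * k, b * k).
Proof.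
by apply: injective_projections; rewrite raddfMz /= mulrzz.
Qed.

Lemma mulrz_pairI (a b : int) :
  (a != 0) || (b != 0) -> injective (fun k : int => (a, b) *~ k).
Proof.
move=> ab k l /=; rewrite !pair_mulrz => -[kl1 kl2].
by case/orP: ab => z0; [move: kl1 | move: kl2] => /(mulfI z0).
Qed.

Lemma subst_intE c (e : int) X k : e != 0 ->
  subst c e X (e * k) = (c ^ k)%:A *: X k.
Proof.
by move=> e0; rewrite -(subst_on c (mulrz_intI e0)) mulrzz.
Qed.

Lemma subst1E c X k : subst c (1 : int) X k = (c ^ k)%:A *: X k.
Proof. by have := @subst_intE c 1 X k isT; rewrite mul1r. Qed.

Lemma substN1E c X k : subst c (- 1 : int) X k = (c ^ (- k))%:A *: X (- k).
Proof. by have := @subst_intE c (-1) X (- k) isT; rewrite mulN1r opprK. Qed.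

Lemma subst11 X : subst 1 (1 : int) X = X.
Proof. by apply/funext => k; rewrite subst1E exp1rz scalemx_alg1. Qed.

Lemma subst1N1E X k : subst 1 (- 1 : int) X k = X (- k).
Proof. by rewrite substN1E exp1rz scalemx_alg1. Qed.

Lemma subst_laurent c (e : int) X : 0 < e -> laurent X -> laurent (subst c e X).
Proof.
move=> e0 /laurentP[m Xm]; apply/laurentP; exists (e * m) => k.
have e0' : e != 0 by rewrite gt_eqF.
case/(subst_neq0 (mulrz_intI e0')) => l -> /Xm ml.
by rewrite mulrzz ler_pM2l.
Qed.

Lemma subst_mono c (e : int) k (M : 'M[A]_n) : e != 0 ->
  subst c e (mono k M) = mono (e * k) ((c ^ k)%:A *: M).
Proof.
move=> e0; apply/esym/subst_ext; first exact: mulrz_intI.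
  move=> l; rewrite /mono mulrzz (inj_eq (mulfI e0)).
  by case: eqP => [->|]; rewrite ?scaler0.
move=> g ge; rewrite /mono; case: eqP => // E; case: (ge k).
by rewrite mulrzz.
Qed.

Lemma subst_cst c (M : 'M[A]_n) : subst c (1 : int) (cst M) = cst M.
Proof. by rewrite [LHS](@subst_mono c 1 0 M)// mulr0 expr0z scalemx_alg1. Qed.

Lemma subst1_smul c X Y : c != 0 -> laurent X -> laurent Y ->
  subst c (1 : int) (X ** Y) = subst c (1 : int) X ** subst c (1 : int) Y.
Proof.
move=> c0 lX lY; apply/funext => k; rewrite subst1E /smul.
rewrite -[LHS]/( *:%R _ _) fsum_raddf; last exact: finite_smul.
apply: eq_fsbigr => h _ /=; rewrite !subst1E mulmx_algr -scalemxAl.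
by rewrite scalemx_algM -expfzDr// subrK.
Qed.

(** Negating the summation index matches the two sums term by term, so the rule also covers series
    in nonpositive powers such as [Tser (-1) L], which may fail [laurent]. *)
Lemma subst1N1_smul X Y :
  subst 1 (- 1 : int) (X ** Y) = subst 1 (- 1 : int) X ** subst 1 (- 1 : int) Y.
Proof.
apply/funext => k; rewrite subst1N1E /smul (reindex_fsbigT (@GRing.opp int)).
  apply: eq_fsbigr => h _ /=; rewrite !subst1N1E; congr (_ *m Y _); lia.
by exists (@GRing.opp int) => h; rewrite opprK.
Qed.

Lemma subst1_subst (a c : C) (e : int) X : a != 0 -> c != 0 -> e != 0 ->
  subst a (1 : int) (subst c e X) = subst (a ^ e * c) e X.
Proof.
move=> a0 c0 e0; apply: subst_ext; first exact: mulrz_intI.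
  move=> k; rewrite subst1E mulrzz subst_intE// scalemx_algM.
  by rewrite exprzMl ?unitfE ?expfz_neq0// exprz_exp.
by move=> g ge; rewrite subst1E subst_off ?scaler0.
Qed.

End Substitution.

Section Specialization.
Variables (C : fieldType) (A : algType C) (n : nat).
Implicit Types (F G : int * int -> 'M[A]_n) (c : C).

(* [spec eps c F] is F(z, c z^eps), for eps = 1 or -1. *)
Definition spec (eps : int) c F : int -> 'M[A]_n := fun k =>
  \sum_(i \in [set: int]) (c ^ (eps * (k - i)))%:A *: F (i, eps * (k - i)).

(** Support in a quadrant. For w = c z^eps the monomial z^i w^j has degree k = i + eps j, so the two
    lower bounds leave finitely many contributions to each k, and [spec] is an honest evaluation. *)
Definition quad (eps : int) F : Prop :=
  exists m, forall i j, F (i, j) <> 0 -> m <= i /\ m <= eps * j.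

Lemma quad_smul (eps : int) F G : quad eps F -> quad eps G -> quad eps (F ** G).
Proof.
move=> [a Fa] [b Gb]; exists (a + b) => i j FG; apply: contrapT => ij.
apply: FG; apply: fsbig1 => -[k l] _; apply: contrapT => /mulmx_neq0[/Fa[ak al] /Gb /=].
by rewrite mulrBr => -[bk bl]; apply: ij; split; lia.
Qed.

(** Both sides expand into finite sums over triples of exponents, which a linear change of indices
    identifies. *)
Lemma spec_smul (eps : int) c F G : eps = 1 \/ eps = -1 -> c != 0 ->
  quad eps F -> quad eps G -> spec eps c (F ** G) = spec eps c F ** spec eps c G.
Proof.
move=> heps c0 [a Fa] [b Gb]; apply/funext => k; rewrite /spec /smul.
have eK x : eps * (eps * x) = x by case: heps => ->; lia.
pose s i := (c ^ (eps * (k - i)))%:A : A.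
transitivity (\sum_(p \in [set: int * (int * int)])
    s p.1 *: (F p.2 *m G ((p.1, eps * (k - p.1)) - p.2))).
  rewrite fsum_pair; last first.
    (* Only [eps * y] is bounded directly, from below by [a] and from above by [k - a - b - b]; the
       symmetric bounds on [y] serve both signs of [eps]. *)
    apply: (@finite_int3 _ _ (a + b) (k - a - b) a (k - a - b - b)
       (- `|a| - `|k - a - b - b|) (`|a| + `|k - a - b - b|)) => i x y /=.
    move=> H; have {H}/mulmx_neq0[/Fa[H1 H2] /Gb[H3 H4]] :
      F (x, y) *m G ((i, eps * (k - i)) - (x, y)) <> 0.
      by move=> E; apply: H; rewrite E scaler0.
    by move: H3 H4 => /= H3; rewrite mulrBr eK => H4; split; case: heps H2 H4 => ->; lia.
  apply: eq_fsbigr => i _; rewrite -[LHS]/( *:%R _ _) fsum_raddf//.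
  apply: (@finite_int2 _ _ a (i - b) (- `|a| - `|k - i - b|) (`|a| + `|k - i - b|)).
  move=> x y /mulmx_neq0[/Fa[H1 H2] /Gb[H3 H4]].
  by move: H3 H4 => /= H3; rewrite mulrBr eK => H4; split; case: heps H2 H4 => ->; lia.
have fin (b' : int) (H : int * int -> 'M[A]_n) l :
    (forall i j, H (i, j) <> 0 -> b' <= i /\ b' <= eps * j) ->
    finite_set ((fun x => (c ^ (eps * (l - x)))%:A *: H (x, eps * (l - x)))
      @^-1` [set~ 0]).
  move=> Hb; apply: (@finite_int1 _ _ b' (l - b')) => i /= H0.
  have {H0}/Hb[] : H (i, eps * (l - i)) <> 0.
    by move=> E; apply: H0; rewrite E scaler0.
  by rewrite eK; lia.
transitivity (\sum_(p \in [set: int * (int * int)])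
    ((c ^ (eps * (p.1 - p.2.1)))%:A *: F (p.2.1, eps * (p.1 - p.2.1))) *m
    ((c ^ (eps * (k - p.1 - p.2.2)))%:A *:
      G (p.2.2, eps * (k - p.1 - p.2.2)))); last first.
  have fz U (x : A) (M : 'M[A]_U) : x *: M <> 0 -> M <> 0.
    by move=> H E; apply: H; rewrite E scaler0.
  rewrite fsum_pair; last first.
    apply: (@finite_int3 _ _ (a + a) (k - b - b) a (k - b - b - a)
       b (k - a - a - b)) => i x y /=.
    move=> /mulmx_neq0[/fz/Fa[H1 H2] /fz/Gb[H3 H4]].
    by rewrite !eK in H2 H4; split; lia.
  apply: eq_fsbigr => l _; rewrite fsum_pair /=; last first.
    apply: (@finite_int2 _ _ a (l - a) b (k - l - b)) => x y /=.
    move=> /mulmx_neq0[/fz/Fa[H1 H2] /fz/Gb[H3 H4]].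
    by rewrite !eK in H2 H4; split; lia.
  rewrite -[RHS]/(mulmxr _ _) fsum_raddf; last exact: (fin a).
  apply: eq_fsbigr => x _ /=.
  by rewrite -[RHS]/(mulmx _ _) fsum_raddf; last exact: (fin b).
(* On the right a triple holds the degree of the first factor after substitution and the z-exponents
   of both factors. On the left it holds the total z-exponent and the exponent pair of the first
   factor. *)
rewrite (reindex_fsbigT (fun p : int * (int * int) =>
  (p.2.1 + p.2.2, (p.2.1, eps * (p.1 - p.2.1))))); last first.
  exists (fun p => (p.2.1 + eps * p.2.2, (p.2.1, p.1 - p.2.1))) => -[i [x y]] /=.
    by rewrite eK; congr (_, (_, _)); lia.
  by congr (_, (_, _)); rewrite ?eK ?[x + _]addrC ?addrK ?subrK ?eK //; case: heps => ->; lia.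
apply: eq_fsbigr => -[l [x y]] _ /=; rewrite /s mulmx_algr -scalemxAl scalemx_algM.
rewrite -expfzDr//.
have E1 : eps * (k - (x + y)) = eps * (k - l - y) + eps * (l - x).
  by rewrite -mulrDr; congr (_ * _); lia.
rewrite E1; congr (_ *: (_ *m G _)); apply: injective_projections => /=; lia.
Qed.

(** The monomial d z^a w^b becomes d c^b z^(a + eps b). When a + eps b = 0 all powers fall into
    degree 0; the ratio z/w at w = c z is such a case and is treated next. *)
Lemma spec_subst (eps : int) c d (a b : int) (X : int -> 'M[A]_n) :
  eps = 1 \/ eps = -1 -> c != 0 -> d != 0 -> a + eps * b != 0 ->
  spec eps c (subst d (a, b) X) = subst (d * c ^ b) (a + eps * b) X.
Proof.
move=> heps c0 d0 ab0.
have eK x : eps * (eps * x) = x by case: heps => ->; lia.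
have inj : injective (fun k : int => (a, b) *~ k).
  apply: mulrz_pairI; apply: contraNT ab0; rewrite negb_or !negbK.
  by case/andP=> /eqP -> /eqP ->; rewrite mulr0.
have supp k i : subst d (a, b) X (i, eps * (k - i)) <> 0 ->
    exists2 j, i = a * j & k = (a + eps * b) * j.
  case/(subst_neq0 inj) => j; rewrite pair_mulrz => -[-> E] _; exists j => //.
  by rewrite mulrDl -mulrA -E eK; lia.
apply: subst_ext; first exact: mulrz_intI.
  move=> k; rewrite mulrzz /spec (@fsum_single _ _ (a * k)); last first.
    move=> i /eqP ik; rewrite [X in _ *: X](_ : _ = 0) ?scaler0//.
    apply: contrapT => /supp[j ij /(mulfI ab0) kj]; apply: ik.
    by rewrite ij kj.
  have -> : eps * ((a + eps * b) * k - a * k) = b * k.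
    by rewrite -[RHS]eK; congr (_ * _); rewrite mulrDl mulrA; lia.
  rewrite -pair_mulrz subst_on// scalemx_algM; congr (_%:A *: _).
  by rewrite exprzMl ?unitfE ?expfz_neq0// exprz_exp mulrC.
move=> g ge; apply: fsbig1 => i _; rewrite [X in _ *: X](_ : _ = 0) ?scaler0//.
apply: contrapT => /supp[j _ gj]; apply: (ge j).
by rewrite gj mulrzz.
Qed.

(* Evaluation at w = c z of a Laurent polynomial in z/w. *)
Lemma spec_subst_ratio c (X : int -> 'M[A]_n) : c != 0 ->
  spec 1 c (subst 1 (1, -1) X) =
  cst (\sum_(k \in [set: int]) (c ^ (- k))%:A *: X k).
Proof.
move=> c0.
have inj : injective (fun k : int => ((1, -1) : int * int) *~ k).
  exact: (@mulrz_pairI 1 (-1) isT).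
apply/funext => k; rewrite /spec /cst; case: eqP => [->|k0].
  apply: eq_fsbigr => i _; rewrite mul1r sub0r; congr (_ *: _).
  have := subst_on 1 inj X i.
  by rewrite pair_mulrz mul1r mulN1r exp1rz scalemx_alg1.
apply: fsbig1 => i _; rewrite [X in _ *: X](_ : _ = 0) ?scaler0//.
apply: contrapT => /(subst_neq0 inj)[j]; rewrite pair_mulrz => -[ij kj] _.
by apply: k0; lia.
Qed.

Lemma quad_subst (eps : int) d (a b m : int) (X : int -> 'M[A]_n) :
  (a != 0) || (b != 0) ->
  (forall k, X k <> 0 -> m <= a * k /\ m <= eps * (b * k)) ->
  quad eps (subst d (a, b) X).
Proof.
move=> ab Xm; exists m => i j /(subst_neq0 (mulrz_pairI ab))[k].
by rewrite pair_mulrz => -[-> ->] /Xm.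
Qed.

End Specialization.

(** * Legs and partial transpositions *)

Notation ij i j := (mxtens_index (i, j)).

(** Transposing a leg reverses the order in which entries are multiplied. Over [A] this is harmless
    for a product of a matrix on that leg with a factor of central entries, such as the image of a
    complex matrix. *)
Definition central_mx (S : pzRingType) m n (M : 'M[S]_(m, n)) : Prop :=
  forall i j (a : S), GRing.comm (M i j) a.

Lemma central_alg (C : fieldType) (A : algType C) m n (M : 'M[C]_(m, n)) :
  central_mx (map_mx (in_alg A) M).
Proof. by move=> i j a; rewrite mxE /GRing.comm mulr_algl mulr_algr. Qed.

Section TensorLegs.
Variables (S : pzRingType) (N : nat).
Implicit Types (X Y : 'M[S]_N) (M : 'M[S]_(N * N)).

Lemma tens_matrixP M M' :
  (forall i1 i2 j1 j2, M (ij i1 i2) (ij j1 j2) = M' (ij i1 i2) (ij j1 j2)) ->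
  M = M'.
Proof.
move=> MM'; apply/matrixP => i j.
by case: (mxtens_indexP i) => i1 i2; case: (mxtens_indexP j) => j1 j2.
Qed.

Lemma tens_sum (V : nmodType) (F : 'I_(N * N) -> V) :
  \sum_k F k = \sum_(k1 < N) \sum_(k2 < N) F (ij k1 k2).
Proof.
rewrite pair_big (reindex (@mxtens_index N N)) /=.
  by apply: eq_bigr => -[].
exists (@mxtens_unindex N N) => i _; [exact: mxtens_indexK | exact: mxtens_unindexK].
Qed.

Lemma mx1E X i1 i2 j1 j2 : mx1 X (ij i1 i2) (ij j1 j2) = X i1 j1 *+ (i2 == j2).
Proof. by rewrite tensmxE mxE mulr_natr. Qed.

Lemma mx2E X i1 i2 j1 j2 : mx2 X (ij i1 i2) (ij j1 j2) = X i2 j2 *+ (i1 == j1).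
Proof. by rewrite tensmxE mxE mulr_natl. Qed.

Lemma mul_mx1l X M i1 i2 j :
  (mx1 X *m M) (ij i1 i2) j = \sum_k X i1 k * M (ij k i2) j.
Proof.
rewrite mxE tens_sum; apply: eq_bigr => k _.
rewrite (bigD1 i2)//= big1 ?addr0 => [|l /negPf li]; rewrite mx1E ?eqxx//.
by rewrite eq_sym li mul0r.
Qed.

Lemma mul_mx1r X M i j1 j2 :
  (M *m mx1 X) i (ij j1 j2) = \sum_k M i (ij k j2) * X k j1.
Proof.
rewrite mxE tens_sum; apply: eq_bigr => k _.
rewrite (bigD1 j2)//= big1 ?addr0 => [|l /negPf li]; rewrite mx1E ?eqxx//.
by rewrite li mulr0.
Qed.

Lemma mul_mx2l X M i1 i2 j :
  (mx2 X *m M) (ij i1 i2) j = \sum_k X i2 k * M (ij i1 k) j.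
Proof.
rewrite mxE tens_sum exchange_big; apply: eq_bigr => k _ /=.
rewrite (bigD1 i1)//= big1 ?addr0 => [|l /negPf li]; rewrite mx2E ?eqxx//.
by rewrite eq_sym li mul0r.
Qed.

Lemma mul_mx2r X M i j1 j2 :
  (M *m mx2 X) i (ij j1 j2) = \sum_k M i (ij j1 k) * X k j2.
Proof.
rewrite mxE tens_sum exchange_big; apply: eq_bigr => k _ /=.
rewrite (bigD1 j1)//= big1 ?addr0 => [|l /negPf li]; rewrite mx2E ?eqxx//.
by rewrite li mulr0.
Qed.

Lemma mx1M X Y : mx1 (X *m Y) = mx1 X *m mx1 Y.
Proof.
apply: tens_matrixP => i1 i2 j1 j2; rewrite mx1E mul_mx1l mxE -sumrMnl.
by apply: eq_bigr => k _; rewrite mx1E mulrnAr.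
Qed.

Lemma mx2M X Y : mx2 (X *m Y) = mx2 X *m mx2 Y.
Proof.
apply: tens_matrixP => i1 i2 j1 j2; rewrite mx2E mul_mx2l mxE -sumrMnl.
by apply: eq_bigr => k _; rewrite mx2E mulrnAr.
Qed.

Lemma mx1_1 : mx1 (1%:M : 'M[S]_N) = 1%:M.
Proof.
apply: tens_matrixP => i1 i2 j1 j2; rewrite mx1E !mxE.
by rewrite (can_eq (@mxtens_indexK N N)) xpair_eqE -mulrnA mulnb.
Qed.

Lemma mx2_1 : mx2 (1%:M : 'M[S]_N) = 1%:M.
Proof. exact: mx1_1. Qed.

Lemma mx12C X Y : comm_entries X Y -> mx1 X *m mx2 Y = mx2 Y *m mx1 X.
Proof.
move=> XY; apply: tens_matrixP => i1 i2 j1 j2; rewrite mul_mx1l mul_mx2l.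
rewrite (bigD1 j1)//= big1 ?addr0 => [|k /negPf kj]; last first.
  by rewrite mx2E kj mulr0.
rewrite (bigD1 j2)//= big1 ?addr0 => [|k /negPf kj]; last first.
  by rewrite mx1E kj mulr0.
by rewrite mx2E mx1E !eqxx; exact: XY.
Qed.

Lemma mx1_is_nmod_morphism : nmod_morphism (@mx1 S N).
Proof.
split=> [|X Y]; apply: tens_matrixP => i1 i2 j1 j2.
  by rewrite mx1E !mxE mul0rn.
by rewrite mx1E mxE [RHS]mxE !mx1E mulrnDl.
Qed.

Lemma mx2_is_nmod_morphism : nmod_morphism (@mx2 S N).
Proof.
split=> [|X Y]; apply: tens_matrixP => i1 i2 j1 j2.
  by rewrite mx2E !mxE mul0rn.
by rewrite mx2E mxE [RHS]mxE !mx2E mulrnDl.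
Qed.

Lemma trmx2E M i1 i2 j1 j2 :
  trmx2 M (ij i1 i2) (ij j1 j2) = M (ij i1 j2) (ij j1 i2).
Proof. by rewrite mxE !mxtens_indexK. Qed.

(** The transposition $t_1$, because the full transposition is the composite of $t_1$ and $t_2$. *)
Definition ptrmx1 M : 'M[S]_(N * N) := (trmx2 M)^T.

Lemma ptrmx1E M i1 i2 j1 j2 :
  ptrmx1 M (ij i1 i2) (ij j1 j2) = M (ij j1 i2) (ij i1 j2).
Proof. by rewrite mxE trmx2E. Qed.

Lemma ptrmx1_is_nmod_morphism : nmod_morphism ptrmx1.
Proof.
split=> [|M M']; apply: tens_matrixP => i1 i2 j1 j2.
  by rewrite ptrmx1E !mxE.
by rewrite ptrmx1E mxE [RHS]mxE !ptrmx1E.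
Qed.

Lemma ptrmx1_mx1l X M : central_mx M -> ptrmx1 (mx1 X *m M) = ptrmx1 M *m mx1 X^T.
Proof.
move=> cM; apply: tens_matrixP => i1 i2 j1 j2.
rewrite ptrmx1E mul_mx1l mul_mx1r; apply: eq_bigr => k _.
by rewrite ptrmx1E mxE; apply/esym; exact: cM.
Qed.

Lemma ptrmx1_mx1r X M : central_mx M -> ptrmx1 (M *m mx1 X) = mx1 X^T *m ptrmx1 M.
Proof.
move=> cM; apply: tens_matrixP => i1 i2 j1 j2.
rewrite ptrmx1E mul_mx1l mul_mx1r; apply: eq_bigr => k _.
by rewrite ptrmx1E mxE; exact: cM.
Qed.

Lemma ptrmx1_mx2l X M : ptrmx1 (mx2 X *m M) = mx2 X *m ptrmx1 M.
Proof.
apply: tens_matrixP => i1 i2 j1 j2; rewrite ptrmx1E !mul_mx2l.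
by apply: eq_bigr => k _; rewrite ptrmx1E.
Qed.

Lemma ptrmx1_mx2r X M : ptrmx1 (M *m mx2 X) = ptrmx1 M *m mx2 X.
Proof.
apply: tens_matrixP => i1 i2 j1 j2; rewrite ptrmx1E !mul_mx2r.
by apply: eq_bigr => k _; rewrite ptrmx1E.
Qed.

Lemma ptrmx1_tr M : ptrmx1 M^T = trmx2 M.
Proof. by apply: tens_matrixP => *; rewrite ptrmx1E mxE trmx2E. Qed.

Lemma PmxE i1 i2 j1 j2 :
  Pmx S N (ij i1 i2) (ij j1 j2) = ((i1 == j2) && (i2 == j1))%:R.
Proof.
rewrite /Pmx summxE; under eq_bigr do rewrite summxE.
rewrite (bigD1 i1)//= (bigD1 i2)//= [X in _ + X + _]big1 ?addr0 => [|b /negPf bi]; last first.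
  by rewrite tensmxE !mxE [i2 == b]eq_sym bi mulr0.
rewrite big1 ?addr0 => [|a /negPf ai]; last first.
  rewrite big1 // => b _.
  by rewrite tensmxE !mxE [i1 == a]eq_sym ai mul0r.
rewrite tensmxE !mxE !eqxx /= -natrM mulnb andbC.
by rewrite [j2 == _]eq_sym [j1 == _]eq_sym.
Qed.

Lemma mul_Pmxl M i1 i2 j : (Pmx S N *m M) (ij i1 i2) j = M (ij i2 i1) j.
Proof.
rewrite mxE tens_sum (bigD1 i2)//= (bigD1 i1)//= PmxE !eqxx mul1r.
rewrite big1 ?addr0 => [|k /negPf ki]; last by rewrite PmxE eq_sym ki mul0r.
rewrite big1 ?addr0 // => k /negPf ki.
by rewrite big1 // => l _; rewrite PmxE [i2 == k]eq_sym ki andbF mul0r.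
Qed.

Lemma mul_Pmxr M i j1 j2 : (M *m Pmx S N) i (ij j1 j2) = M i (ij j2 j1).
Proof.
rewrite mxE tens_sum (bigD1 j2)//= (bigD1 j1)//= PmxE !eqxx mulr1.
rewrite big1 ?addr0 => [|k /negPf ki]; last by rewrite PmxE ki andbF mulr0.
rewrite big1 ?addr0 // => k /negPf ki.
by rewrite big1 // => l _; rewrite PmxE ki mulr0.
Qed.

Lemma PmxK : Pmx S N *m Pmx S N = 1%:M.
Proof.
apply: tens_matrixP => i1 i2 j1 j2; rewrite mul_Pmxl PmxE mxE.
by rewrite (can_eq (@mxtens_indexK N N)) xpair_eqE andbC.
Qed.

Lemma Pmx_mx1 X : Pmx S N *m mx1 X = mx2 X *m Pmx S N.
Proof.
by apply: tens_matrixP => i1 i2 j1 j2; rewrite mul_Pmxl mul_Pmxr mx1E mx2E.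
Qed.

Lemma Pmx_mx2 X : Pmx S N *m mx2 X = mx1 X *m Pmx S N.
Proof.
by apply: tens_matrixP => i1 i2 j1 j2; rewrite mul_Pmxl mul_Pmxr mx1E mx2E.
Qed.

(** This is v v^t for the vector v = sum_a e_a tensor e_a. [Qmx V] is its conjugate by V_1 divided
    by N. *)
Definition Kmx : 'M[S]_(N * N) := trmx2 (Pmx S N).

Lemma KmxE i1 i2 j1 j2 :
  Kmx (ij i1 i2) (ij j1 j2) = ((i1 == i2) && (j1 == j2))%:R.
Proof. by rewrite trmx2E PmxE [j2 == _]eq_sym. Qed.

(** Each entry of either product is 0 or a single entry of [X], so the identity holds for entries in
    a noncommutative ring. *)
Lemma Kmx_mx1 X : Kmx *m mx1 X^T = Kmx *m mx2 X.
Proof.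
apply: tens_matrixP => i1 i2 j1 j2; rewrite mul_mx1r mul_mx2r.
rewrite [LHS](bigD1 j2)//= [RHS](bigD1 j1)//= !big1 ?addr0 => [|k /negPf kj|k /negPf kj].
- by rewrite !KmxE !eqxx mxE.
- by rewrite KmxE ?[j1 == k]eq_sym kj andbF mul0r.
- by rewrite KmxE ?[j1 == k]eq_sym kj andbF mul0r.
Qed.

Lemma mx1_Kmx X : mx1 X^T *m Kmx = mx2 X *m Kmx.
Proof.
apply: tens_matrixP => i1 i2 j1 j2; rewrite mul_mx1l mul_mx2l.
rewrite [LHS](bigD1 i2)//= [RHS](bigD1 i1)//= !big1 ?addr0 => [|k /negPf kj|k /negPf kj].
- by rewrite !KmxE !eqxx mxE.
- by rewrite KmxE ?[i1 == k]eq_sym kj mulr0.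
- by rewrite KmxE ?[i1 == k]eq_sym kj mulr0.
Qed.

Lemma Pmx_Kmx : Pmx S N *m Kmx = Kmx.
Proof.
by apply: tens_matrixP => i1 i2 j1 j2; rewrite mul_Pmxl !KmxE [i2 == _]eq_sym.
Qed.

Lemma Kmx_Pmx : Kmx *m Pmx S N = Kmx.
Proof.
by apply: tens_matrixP => i1 i2 j1 j2; rewrite mul_Pmxr !KmxE [j2 == _]eq_sym.
Qed.

(** Rank one: the product is v (v^t M v) v^t, and the scalar is v^t M v. *)
Lemma KmxK M : Kmx *m M *m Kmx = (\sum_a \sum_b M (ij a a) (ij b b)) *: Kmx.
Proof.
apply: tens_matrixP => i1 i2 j1 j2; rewrite [RHS]mxE KmxE.
have KM j : (Kmx *m M) (ij i1 i2) j = (i1 == i2)%:R * \sum_a M (ij a a) j.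
  rewrite mxE tens_sum mulr_sumr; apply: eq_bigr => k _.
  rewrite (bigD1 k)//= big1 ?addr0 => [|l /negPf lk].
    by rewrite KmxE eqxx andbT.
  by rewrite KmxE [k == l]eq_sym lk andbF mul0r.
transitivity (\sum_b (i1 == i2)%:R * (\sum_a M (ij a a) (ij b b)) * (j1 == j2)%:R).
  rewrite mxE tens_sum; apply: eq_bigr => k _.
  rewrite (bigD1 k)//= big1 ?addr0 => [|l /negPf lk]; last first.
    by rewrite KmxE [k == l]eq_sym lk mulr0.
  by rewrite KM KmxE eqxx.
rewrite -mulr_suml -mulr_sumr exchange_big -mulnb natrM mulrA.
by congr (_ * _); rewrite mulr_natl mulr_natr.
Qed.

End TensorLegs.

HB.instance Definition _ (S : pzRingType) N :=
  GRing.isNmodMorphism.Build _ _ (@mx1 S N) (@mx1_is_nmod_morphism S N).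
HB.instance Definition _ (S : pzRingType) N :=
  GRing.isNmodMorphism.Build _ _ (@mx2 S N) (@mx2_is_nmod_morphism S N).
HB.instance Definition _ (S : pzRingType) N :=
  GRing.isNmodMorphism.Build _ _ (@ptrmx1 S N) (@ptrmx1_is_nmod_morphism S N).

Section MapTensor.
Variables (S S' : pzRingType) (f : {rmorphism S -> S'}) (N : nat).
Local Notation "M ^f" := (map_mx f M).

Lemma map_leg1 (X : 'M[S]_N) : (mx1 X)^f = mx1 X^f.
Proof. by apply: tens_matrixP => *; rewrite mxE !mx1E mxE rmorphMn. Qed.

Lemma map_leg2 (X : 'M[S]_N) : (mx2 X)^f = mx2 X^f.
Proof. by apply: tens_matrixP => *; rewrite mxE !mx2E mxE rmorphMn. Qed.

Lemma map_ptrmx1 (M : 'M[S]_(N * N)) : (ptrmx1 M)^f = ptrmx1 M^f.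
Proof. by apply: tens_matrixP => *; rewrite mxE !ptrmx1E mxE. Qed.

Lemma map_Pmx : (Pmx S N)^f = Pmx S' N.
Proof. by apply: tens_matrixP => *; rewrite mxE !PmxE rmorph_nat. Qed.

Lemma map_Kmx : (Kmx S N)^f = Kmx S' N.
Proof. by apply: tens_matrixP => *; rewrite mxE !KmxE rmorph_nat. Qed.

End MapTensor.

Lemma laurent_map (S S' : pzRingType) n n' (f : 'M[S]_n -> 'M[S']_n') X :
  f 0 = 0 -> laurent X -> laurent (fun k => f (X k)).
Proof. by move=> f0 [m Xm]; exists m => k /Xm ->. Qed.

Definition tr1 (S : pzRingType) N (Z : int -> 'M[S]_(N * N)) :
  int -> 'M[S]_(N * N) := fun k => ptrmx1 (Z k).

Section LaurentClosure.
Variables (S : pzRingType) (N : nat).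
Implicit Types (X : int -> 'M[S]_N) (Z : int -> 'M[S]_(N * N)).

Lemma laurent_sp1 X : laurent X -> laurent (sp1 X).
Proof. exact: (laurent_map (f := @mx1 S N) (raddf0 _)). Qed.

Lemma laurent_sp2 X : laurent X -> laurent (sp2 X).
Proof. exact: (laurent_map (f := @mx2 S N) (raddf0 _)). Qed.

Lemma laurent_str X : laurent X -> laurent (str X).
Proof. exact: (laurent_map (f := @trmx S N N) (trmx0 _ _ _)). Qed.

Lemma laurent_tr1 Z : laurent Z -> laurent (tr1 Z).
Proof. exact: (laurent_map (f := @ptrmx1 S N) (raddf0 _)). Qed.

Lemma laurent_swap Z : laurent Z -> laurent (swap Z).
Proof.
apply: (laurent_map (f := fun M => Pmx S N *m M *m Pmx S N)).
by rewrite mulmx0 mul0mx.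
Qed.

End LaurentClosure.

Lemma laurent_emb (C : fieldType) (A : algType C) n (X : int -> 'M[C]_n) :
  laurent X -> laurent (emb A X).
Proof. exact: (laurent_map (f := map_mx (in_alg A)) (raddf0 _)). Qed.

(** Associativity has three side conditions at each use. The tactic follows the construction of a
    series and, registered as a hint, lets [//] close them; under [subst] the exponent has to be
    visibly positive. *)
Ltac laur := try assumption; lazymatch goal with
  | |- laurent (_ ** _) => apply: laurent_smul; laur
  | |- laurent (cst _) => exact: laurent_cst
  | |- laurent (mono _ _) => exact: laurent_mono
  | |- laurent (sp1 _) => apply: laurent_sp1; laur
  | |- laurent (sp2 _) => apply: laurent_sp2; laur
  | |- laurent (str _) => apply: laurent_str; laur
  | |- laurent (tr1 _) => apply: laurent_tr1; laur
  | |- laurent (swap _) => apply: laurent_swap; laur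
  | |- laurent (emb _ _) => apply: laurent_emb; laur
  | |- laurent (subst _ _ _) => apply: subst_laurent; [by [] | laur]
  end.
#[export] Hint Extern 0 (laurent _) => solve [laur] : core.

(** * Exchange relations for series acting on two legs *)

Section SeriesLegs.
Variables (S : pzRingType) (N : nat).
Implicit Types (X Y : int -> 'M[S]_N) (Z : int -> 'M[S]_(N * N)).

(** A relation between two-letter words in the shape that rewrites at the head of a right-nested
    product. *)
Lemma smulL n (a b c d t : int -> 'M[S]_n) : a ** b = c ** d ->
  laurent a -> laurent b -> laurent c -> laurent d -> laurent t ->
  a ** (b ** t) = c ** (d ** t).
Proof. by move=> E *; rewrite !smulA // E. Qed.

Lemma smulL1 n (a b c t : int -> 'M[S]_n) : a ** b = c ->
  laurent a -> laurent b -> laurent t -> a ** (b ** t) = c ** t.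
Proof. by move=> E *; rewrite !smulA // E. Qed.

(** Serves wherever the order of two factors is reversed, since in a Cauchy product the summation
    index is attached to the left factor. *)
Lemma smul_rev m n (a b : int -> 'M[S]_m) (f : 'M[S]_m -> 'M[S]_m -> 'M[S]_n) k :
  \sum_(h \in [set: int]) f (a h) (b (k - h)) =
  \sum_(h \in [set: int]) f (a (k - h)) (b h).
Proof.
rewrite (reindex_fsbigT (fun h : int => k - h)).
  by apply: eq_fsbigr => h _; rewrite subKr.
by exists (fun h => k - h) => h; rewrite subKr.
Qed.

Lemma sp1_smul X Y : laurent X -> laurent Y -> sp1 (X ** Y) = sp1 X ** sp1 Y.
Proof.
move=> lX lY; apply/funext => k; rewrite /sp1 /smul fsum_raddf.
  by apply: eq_fsbigr => h _; exact: mx1M.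
exact: finite_smul.
Qed.

Lemma sp2_smul X Y : laurent X -> laurent Y -> sp2 (X ** Y) = sp2 X ** sp2 Y.
Proof.
move=> lX lY; apply/funext => k; rewrite /sp2 /smul fsum_raddf.
  by apply: eq_fsbigr => h _; exact: mx2M.
exact: finite_smul.
Qed.

Lemma sp1_cst (G : zmodType) (M : 'M[S]_N) : sp1 (cst M) = cst (mx1 M) :> (G -> _).
Proof. by apply/funext => k; rewrite /sp1 /cst; case: ifP; rewrite ?raddf0. Qed.

Lemma sp2_cst (G : zmodType) (M : 'M[S]_N) : sp2 (cst M) = cst (mx2 M) :> (G -> _).
Proof. by apply/funext => k; rewrite /sp2 /cst; case: ifP; rewrite ?raddf0. Qed.

Lemma sp12C X Y : (forall h l, comm_entries (X h) (Y l)) ->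
  sp1 X ** sp2 Y = sp2 Y ** sp1 X.
Proof.
move=> XY; apply/funext => k.
rewrite /smul (smul_rev (sp1 X) (sp2 Y) (fun a b => a *m b)).
by apply: eq_fsbigr => h _; apply: mx12C; exact: XY.
Qed.

Lemma central_comm (r M : 'M[S]_N) : central_mx r -> comm_entries r M.
Proof. by move=> cr a b c d; exact: cr. Qed.

Lemma comm_central (r M : 'M[S]_N) : central_mx r -> comm_entries M r.
Proof. by move=> cr a b c d; exact/commr_sym/cr. Qed.

Lemma tr1_sp1l X Z : laurent X -> laurent Z -> (forall k, central_mx (Z k)) ->
  tr1 (sp1 X ** Z) = tr1 Z ** sp1 (str X).
Proof.
move=> lX lZ cZ; apply/funext => k; rewrite /tr1 /smul fsum_raddf.
  rewrite (smul_rev _ _ (fun a b => ptrmx1 (a *m b))).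
  by apply: eq_fsbigr => h _; rewrite ptrmx1_mx1l.
exact: finite_smul.
Qed.

Lemma tr1_sp1r X Z : laurent X -> laurent Z -> (forall k, central_mx (Z k)) ->
  tr1 (Z ** sp1 X) = sp1 (str X) ** tr1 Z.
Proof.
move=> lX lZ cZ; apply/funext => k; rewrite /tr1 /smul fsum_raddf.
  rewrite (smul_rev _ _ (fun a b => ptrmx1 (a *m b))).
  by apply: eq_fsbigr => h _; rewrite ptrmx1_mx1r.
exact: finite_smul.
Qed.

Lemma tr1_sp2l X Z : laurent X -> laurent Z ->
  tr1 (sp2 X ** Z) = sp2 X ** tr1 Z.
Proof.
move=> lX lZ; apply/funext => k; rewrite /tr1 /smul fsum_raddf.
  by apply: eq_fsbigr => h _; exact: ptrmx1_mx2l.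
exact: finite_smul.
Qed.

Lemma tr1_sp2r X Z : laurent X -> laurent Z ->
  tr1 (Z ** sp2 X) = tr1 Z ** sp2 X.
Proof.
move=> lX lZ; apply/funext => k; rewrite /tr1 /smul fsum_raddf.
  by apply: eq_fsbigr => h _; exact: ptrmx1_mx2r.
exact: finite_smul.
Qed.

(** Transposition in leg 1 exchanges [Z] with X_1 and leaves Y_2 in place. So [Z] moves from the
    ends of the word to its middle, the place that Rbar has in the contraction, and the entries of
    [X] and [Y] keep their order. *)
Lemma exchange_tr1 X Y Z : laurent X -> laurent Y -> laurent Z ->
  (forall k, central_mx (Z k)) ->
  Z ** sp1 X ** sp2 Y = sp2 Y ** sp1 X ** Z ->
  sp1 (str X) ** tr1 Z ** sp2 Y = sp2 Y ** tr1 Z ** sp1 (str X).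
Proof.
move=> lX lY lZ cZ E; rewrite -tr1_sp1r// -tr1_sp2r// E.
by rewrite -smulA// tr1_sp2l// tr1_sp1l// smulA.
Qed.

(** U_1 squares to 1 and commutes with Y_2, so its inner copies cancel and the outer ones can be
    carried through Y_2. *)
Lemma exchange_conj X Y Z (U : 'M[S]_N) : laurent X -> laurent Y -> laurent Z ->
  central_mx U -> U *m U = 1%:M ->
  sp1 X ** Z ** sp2 Y = sp2 Y ** Z ** sp1 X ->
  sp1 (cst U ** X ** cst U) ** (cst (mx1 U) ** Z ** cst (mx1 U)) ** sp2 Y =
  sp2 Y ** (cst (mx1 U) ** Z ** cst (mx1 U)) ** sp1 (cst U ** X ** cst U).
Proof.
move=> lX lY lZ cU UU E; rewrite !sp1_smul// sp1_cst; set u := cst (mx1 U).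
have lu : laurent u by exact: laurent_cst.
have uu : u ** u = cst 1%:M by rewrite /u cstM -mx1M UU mx1_1.
have uY : u ** sp2 Y = sp2 Y ** u.
  rewrite /u -sp1_cst; apply: sp12C => h l; apply: central_comm => i j a.
  by rewrite /cst; case: ifP => // _; rewrite mxE; exact: commr_sym (commr0 _).
rewrite -!smulA// !(smulL1 uu)// !smul1s uY -(smulL uY)//.
have -> : sp1 X ** (Z ** (sp2 Y ** u)) = sp1 X ** Z ** sp2 Y ** u by rewrite !smulA.
by rewrite E -!smulA.
Qed.

End SeriesLegs.

Section Embedding.
Variables (C : fieldType) (A : algType C) (n : nat).
Implicit Types X Y : int -> 'M[C]_n.

Lemma emb_smul X Y : laurent X -> laurent Y -> emb A (X ** Y) = emb A X ** emb A Y.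
Proof.
move=> lX lY; apply/funext => k; rewrite /emb /smul fsum_raddf.
  by apply: eq_fsbigr => h _; exact: map_mxM.
exact: finite_smul.
Qed.

Lemma emb_cst (G : zmodType) (M : 'M[C]_n) :
  emb A (cst M) = cst (map_mx (in_alg A) M) :> (G -> _).
Proof. by apply/funext => k; rewrite /emb /cst; case: ifP; rewrite ?map_mx0. Qed.

Lemma emb_subst (G : zmodType) (c : C) (e : G) X :
  injective (fun k : int => e *~ k) ->
  emb A (subst (A := C^o) c e X) = subst c e (emb A X).
Proof.
move=> inj; apply: subst_ext => //.
  move=> k; rewrite /emb (@subst_on _ C^o)//; apply/matrixP => i j.
  by rewrite !mxE /= mulr_algl [RHS]mulr_algl scalerA.
by move=> g ge; rewrite /emb (@subst_off _ C^o)// map_mx0.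
Qed.

End Embedding.

Section SubstLegs.
Variables (C : fieldType) (A : algType C) (N : nat) (G : zmodType).
Variables (c : C) (e : G).
Hypothesis e_inj : injective (fun k : int => e *~ k).

Lemma mx1Z (a : A) (M : 'M[A]_N) : mx1 (a *: M) = a *: mx1 M.
Proof. by apply: tens_matrixP => *; rewrite [RHS]mxE !mx1E mxE mulrnAr. Qed.

Lemma mx2Z (a : A) (M : 'M[A]_N) : mx2 (a *: M) = a *: mx2 M.
Proof. by apply: tens_matrixP => *; rewrite [RHS]mxE !mx2E mxE mulrnAr. Qed.

Lemma sp1_subst (X : int -> 'M[A]_N) : sp1 (subst c e X) = subst c e (sp1 X).
Proof.
apply: subst_ext => // [k|g ge]; first by rewrite /sp1 subst_on// mx1Z.
by rewrite /sp1 subst_off// raddf0.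
Qed.

Lemma sp2_subst (X : int -> 'M[A]_N) : sp2 (subst c e X) = subst c e (sp2 X).
Proof.
apply: subst_ext => // [k|g ge]; first by rewrite /sp2 subst_on// mx2Z.
by rewrite /sp2 subst_off// raddf0.
Qed.

End SubstLegs.

Lemma swap_subst (C : fieldType) (A : algType C) N (c : C) (e : int)
    (Z : int -> 'M[A]_(N * N)) :
  e != 0 -> swap (subst c e Z) = subst c e (swap Z).
Proof.
move=> /mulrz_intI e_inj; apply: subst_ext => // [k|g ge].
  by rewrite /swap subst_on// mulmx_algr -scalemxAl.
by rewrite /swap subst_off// mulmx0 mul0mx.
Qed.

Lemma emb_swap (C : fieldType) (A : algType C) N (Z : int -> 'M[C]_(N * N)) :
  emb A (swap Z) = swap (emb A Z).
Proof. by apply/funext => k; rewrite /emb /swap !map_mxM map_Pmx. Qed.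

Lemma emb_sp1 (C : fieldType) (A : algType C) N (X : int -> 'M[C]_N) :
  emb A (sp1 X) = sp1 (emb A X).
Proof. by apply/funext => k; exact: map_leg1. Qed.

Lemma emb_sp2 (C : fieldType) (A : algType C) N (X : int -> 'M[C]_N) :
  emb A (sp2 X) = sp2 (emb A X).
Proof. by apply/funext => k; exact: map_leg2. Qed.

(** * The R-matrix *)

Section RMatrix.
Variables (C : fieldType) (N : nat) (q : C).
Local Notation h := (q - q^-1).
Local Notation P := (Pmx C N).
(** With these signs R(z) = z Ap - z^-1 Am. *)
Local Notation Ap := (Rser N q 1).
Local Notation Am := (- Rser N q (-1)).

(** All three sums in R have this shape: the row indices select the single term a = i1, b = i2, and
    [u], [v] give its column indices. *)
Lemma sum_tens_deltaE (p : 'I_N -> 'I_N -> bool) (F : 'I_N -> 'I_N -> C)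
    (u v : 'I_N -> 'I_N -> 'I_N) i1 i2 j1 j2 :
  (\sum_a \sum_(b | p a b)
     F a b *: tensmx (delta_mx a (u a b)) (delta_mx b (v a b)))
    (ij i1 i2) (ij j1 j2) =
  ([&& p i1 i2, j1 == u i1 i2 & j2 == v i1 i2])%:R * F i1 i2.
Proof.
rewrite summxE (bigD1 i1)//= [X in _ + X]big1 ?addr0 => [|a /negPf ai].
  rewrite summxE big_mkcond (bigD1 i2)//= [X in _ + X]big1 ?addr0 => [|b /negPf bi].
    case: (p i1 i2); rewrite ?mul0r//= mxE tensmxE !mxE !eqxx -natrM mulnb.
    by rewrite mulrC.
  by case: ifP => // _; rewrite mxE tensmxE !mxE [i2 == b]eq_sym bi !mulr0.
rewrite summxE big1 // => b _.
by rewrite mxE tensmxE !mxE [i1 == a]eq_sym ai mul0r mulr0.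
Qed.

Lemma RserE k i1 i2 j1 j2 :
  Rser N q k (ij i1 i2) (ij j1 j2) =
  ((i1 == j1) && (i2 == j2))%:R * (if i1 == i2 then acoef q k else bcoef C k)
  + [&& i1 == j2, i2 == j1, i1 != i2 & k == sgz (i2%:Z - i1%:Z)]%:R * h.
Proof.
have E1 : \sum_(a < N) tensmx (delta_mx a a) (delta_mx a a) =
    \sum_(a < N) \sum_(b < N | a == b) 1 *: tensmx (delta_mx a a) (delta_mx b b)
    :> 'M[C]_(N * N).
  by apply: eq_bigr => a _; rewrite (big_pred1 a) ?scale1r.
have E2 : \sum_(a < N) \sum_(b < N | a != b) tensmx (delta_mx a a) (delta_mx b b) =
    \sum_(a < N) \sum_(b < N | a != b) 1 *: tensmx (delta_mx a a) (delta_mx b b)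
    :> 'M[C]_(N * N).
  by apply: eq_bigr => a _; apply: eq_bigr => b _; rewrite scale1r.
rewrite /Rser E1 E2 !mxE.
rewrite (sum_tens_deltaE (fun a b => a == b) (fun _ _ => 1) (fun a b => a) (fun a b => b)).
rewrite (sum_tens_deltaE (fun a b => a != b) (fun _ _ => 1) (fun a b => a) (fun a b => b)).
rewrite (sum_tens_deltaE (fun a b => a != b) (fun a b => (k == sgz (b%:Z - a%:Z))%:R)
  (fun a b => b) (fun a b => a)).
rewrite ![j1 == _]eq_sym ![j2 == _]eq_sym.
congr (_ + _).
  by case: (i1 == i2) => /=; rewrite !(mul0r, mulr0, addr0, add0r, mulr1) mulrC.
rewrite mulrC -natrM mulnb; congr (_%:R * _).
by case: (i1 == j2); case: (i2 == j1); case: (i1 == i2) => /=; rewrite ?andbF.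
Qed.

Lemma Rser_support k : k != 1 -> k != -1 -> Rser N q k = 0.
Proof.
move=> /negPf k1 /negPf kN1; apply: tens_matrixP => i1 i2 j1 j2.
rewrite RserE [RHS]mxE /acoef /bcoef k1 kN1 !mul0r subrr if_same mulr0 add0r.
case: (boolP [&& _, _, _ & _]) => [/and4P[_ _ i12 /eqP kE]|]; last by rewrite mul0r.
have : (i2 : nat) != i1 by rewrite eq_sym.
by move: k1 kN1; rewrite kE; case: sgzP => //; lia.
Qed.

(** Transposition and exchange of the factors both send E_ab tensor E_ba to E_ba tensor E_ab, and
    the diagonal part is invariant under either. *)
Lemma Rser_tr k : P *m Rser N q k *m P = (Rser N q k)^T.
Proof.
apply: tens_matrixP => i1 i2 j1 j2; rewrite mul_Pmxr mul_Pmxl [RHS]mxE !RserE.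
rewrite [j1 == i1]eq_sym [j2 == i2]eq_sym [j1 == i2]eq_sym [j2 == i1]eq_sym.
congr (_ + _%:R * _).
- case: (i1 =P j1) => [->|]; case: (i2 =P j2) => [->|]; rewrite /= ?mul0r//.
  by rewrite [j2 == j1]eq_sym.
- case: (i1 =P j2) => [->|]; rewrite ?andbF//.
  by case: (i2 =P j1) => [->|]; rewrite ?andbF.
Qed.

(** This is the value R(1): there b vanishes and a equals q - q^-1. It is the source of the rank-one
    value of Rbar at rho^-1. *)
Lemma Rser_sum1 : Rser N q 1 + Rser N q (-1) = h *: P.
Proof.
apply: tens_matrixP => i1 i2 j1 j2; rewrite mxE [RHS]mxE PmxE !RserE.
rewrite /acoef /bcoef /= !(mul1r, mul0r, subr0, sub0r).
case: (i1 =P i2) => [->|/eqP i12] /=.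
  rewrite !andbF !mul0r !addr0 -mulrDr mulrC; congr (_ * _%:R).
  by case: (i2 =P j1) => [->|]; case: (_ =P j2); rewrite ?andbF ?andbT.
have i21 : (i2 : nat) != i1 by rewrite eq_sym.
rewrite mulr1 mulrN1 addrACA subrr add0r -mulrDl mulrC; congr (_ * _).
rewrite !andbA; case: ((i1 == j2) && (i2 == j1)) => /=; last by rewrite addr0.
by case: sgzP => /=; rewrite ?addr0 ?add0r//; lia.
Qed.

(** An antidiagonal [V] reverses the order of the indices and thereby flips sgn(b - a), as the
    exchange of the factors does; the coefficients of [V] occur symmetrically on the two sides. *)
Lemma Rser_VV (V : 'M[C]_N) k :
  (forall a b, b != rev_ord a -> V a b = 0) ->
  mx1 V *m mx2 V *m Rser N q k = P *m Rser N q k *m P *m (mx1 V *m mx2 V).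
Proof.
move=> Vrev.
have suml i (F : 'I_N -> C) : \sum_k V i k * F k = V i (rev_ord i) * F (rev_ord i).
  rewrite (bigD1 (rev_ord i))//= big1 ?addr0// => l /Vrev ->.
  by rewrite mul0r.
have sumr j (F : 'I_N -> C) :
    \sum_k F k * V k (rev_ord j) = F j * V j (rev_ord j).
  rewrite (bigD1 j)//= big1 ?addr0// => l lj.
  by rewrite Vrev ?mulr0// (inj_eq rev_ord_inj) eq_sym.
apply: tens_matrixP => i1 i2 j1 j2; rewrite -mulmxA mul_mx1l suml mul_mx2l suml.
rewrite -[j1]rev_ordK -[j2]rev_ordK mulmxA mul_mx2r sumr mul_mx1r sumr.
move: (rev_ord j1) (rev_ord j2) => {}j1 {}j2.
rewrite mul_Pmxr mul_Pmxl !RserE !(inj_eq rev_ord_inj).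
have -> : sgz ((rev_ord i2)%:Z - (rev_ord i1)%:Z) = sgz (i1%:Z - i2%:Z).
  congr sgz; rewrite /=; have := ltn_ord i1; have := ltn_ord i2; lia.
rewrite [(i2 == j2) && (i1 == j1)]andbC [i2 == i1]eq_sym.
rewrite (_ : [&& i2 == j1, i1 == j2, ~~ (i1 == i2) & k == sgz (i1%:Z - i2%:Z)] =
  [&& i1 == j2, i2 == j1, ~~ (i1 == i2) & k == sgz (i1%:Z - i2%:Z)]); last first.
  by rewrite andbCA.
rewrite !mulrDr !mulrDl; congr (_ + _).
  case: (i1 =P j1) => [->|]; case: (i2 =P j2) => [->|];
    rewrite /= ?(mul0r, mulr0, mul1r) //; ring.
case: (i1 =P j2) => [->|]; case: (i2 =P j1) => [->|];
    rewrite /= ?(mul0r, mulr0, mul1r) //; ring.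
Qed.

Hypothesis q0 : q != 0.

(** Ap P is the constant braid matrix, and this is its Hecke relation (c - q)(c + q^-1) = 0, from
    which unitarity is derived. *)
Lemma Rser_hecke : (Ap *m P) *m (Ap *m P) = h *: (Ap *m P) + 1%:M.
Proof.
have cE i1 i2 j1 j2 : (Ap *m P) (ij i1 i2) (ij j1 j2) =
    ((i1 == j2) && (i2 == j1))%:R * (if i1 == i2 then q else 1) +
    [&& i1 == j1, i2 == j2 & (i1 < i2)%N]%:R * h.
  rewrite mul_Pmxr RserE /acoef /bcoef /= mul0r mul1r !subr0.
  congr (_ + _%:R * _); congr [&& _, _ & _].
  have [->|i12] := eqVneq i1 i2; first by rewrite ltnn.
  have i21 : (i2 : nat) != i1 by rewrite eq_sym.
  by case: sgzP => /=; lia.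
apply: tens_matrixP => i1 i2 j1 j2; rewrite [LHS]mxE tens_sum.
(* The row (i1, i2) of Ap P has at most two nonzero entries: in column (i2, i1), and in column (i1,
   i2) when i1 < i2. *)
transitivity ((if i1 == i2 then q else 1) * (Ap *m P) (ij i2 i1) (ij j1 j2) +
    (i1 < i2)%:R * h * (Ap *m P) (ij i1 i2) (ij j1 j2)).
  transitivity (\sum_(k1 < N) \sum_(k2 < N)
    (((k1 == i2) && (k2 == i1))%:R * ((if i1 == i2 then q else 1) *
       (Ap *m P) (ij i2 i1) (ij j1 j2)) +
     ((k1 == i1) && (k2 == i2))%:R * ((i1 < i2)%:R * h *
       (Ap *m P) (ij i1 i2) (ij j1 j2)))).
    apply: eq_bigr => k1 _; apply: eq_bigr => k2 _.
    rewrite cE mulrDl; congr (_ + _).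
      rewrite [i1 == k2]eq_sym [i2 == k1]eq_sym [(k2 == i1) && _]andbC.
      by case: eqP => [->|]; case: eqP => [->|]; rewrite ?(mul0r, mul1r).
    rewrite [i1 == k1]eq_sym [i2 == k2]eq_sym.
    case: eqP => [->|]; case: eqP => [->|]; rewrite ?(mul0r, mul1r)//=.
  have sum2 (x1 x2 : 'I_N) (a : C) :
      \sum_(k1 < N) \sum_(k2 < N) ((k1 == x1) && (k2 == x2))%:R * a = a.
    rewrite (bigD1 x1)//= [X in _ + X]big1 ?addr0 => [|k /negPf ->]; last first.
      by apply: big1 => l _; rewrite mul0r.
    rewrite (bigD1 x2)//= [X in _ + X]big1 ?addr0 => [|k /negPf ->].
      by rewrite !eqxx mul1r.
    by rewrite andbF mul0r.
  by under eq_bigr do rewrite big_split; rewrite big_split /= !sum2.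
rewrite [RHS]mxE [X in _ = X + _]mxE [X in _ = _ + X]mxE.
rewrite (can_eq (@mxtens_indexK N N)) xpair_eqE !cE.
have [<-|i12] := eqVneq i1 i2.
  rewrite ?eqxx ltnn !andbF !mul0r !addr0.
  have -> : (i1 == j1) && (i1 == j2) = (i1 == j2) && (i1 == j1) by rewrite andbC.
  case: (_ && _); rewrite ?(mul0r, mulr0, addr0)// mul1r.
  by rewrite /= mulrBl mulVf// subrK.
rewrite !mul1r !mulr1.
have i21 : (i2 : nat) != i1 by rewrite eq_sym.
rewrite [(i2 == j2) && (i1 == j1)]andbC.
rewrite (_ : [&& i2 == j1, i1 == j2 & (i2 < i1)%N] =
  [&& i1 == j2, i2 == j1 & (i2 < i1)%N]); last by rewrite andbCA.
have [lt12|ge12] := ltnP i1 i2.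
  have -> : (i2 < i1)%N = false by lia.
  by rewrite !andbF mul0r addr0 mul1r addrC.
have -> : (i2 < i1)%N by lia.
by rewrite !andbT !andbF !mul0r !addr0 addrC mulrC.
Qed.

End RMatrix.

(** * Unitarity and the inverted exchange relation *)

Section Differences.
Variables (S : pzRingType) (n : nat).
Implicit Types X Y Z : int -> 'M[S]_n.

Lemma fsumB (V : zmodType) (I : choiceType) (f g : I -> V) :
  finite_set (f @^-1` [set~ 0]) -> finite_set (g @^-1` [set~ 0]) ->
  \sum_(i \in [set: I]) (f i - g i) =
  \sum_(i \in [set: I]) f i - \sum_(i \in [set: I]) g i.
Proof.
move=> finf fing; pose D := f @^-1` [set~ 0] `|` g @^-1` [set~ 0].
have finD : finite_set D by rewrite finite_setU.
have f0 i : ~ D i -> f i = 0.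
  by move=> Di; apply: contrapT => fi; apply: Di; left.
have g0 i : ~ D i -> g i = 0.
  by move=> Di; apply: contrapT => gi; apply: Di; right.
have toD (F : I -> V) : (forall i, ~ D i -> F i = 0) ->
    \sum_(i \in [set: I]) F i = \sum_(i <- fset_set D) F i.
  move=> F0; rewrite -fsbig_finite//; apply/esym/fsbig_widen => // i [_].
  exact: F0.
by rewrite !toD ?sumrB// => i Di; rewrite f0// g0// subrr.
Qed.

Lemma laurentB X Y : laurent X -> laurent Y -> laurent (fun k => X k - Y k).
Proof.
move=> [a Xa] [b Yb]; exists (Num.min a b) => k.
by rewrite lt_min => /andP[/Xa -> /Yb ->]; rewrite subrr.
Qed.

Lemma smulBl X Y Z : laurent X -> laurent Y -> laurent Z ->
  (fun k => X k - Y k) ** Z = (fun k => (X ** Z) k - (Y ** Z) k).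
Proof.
move=> lX lY lZ; apply/funext => k; rewrite /smul -fsumB; try exact: finite_smul.
by apply: eq_fsbigr => h _; rewrite mulmxBl.
Qed.

Lemma smulBr X Y Z : laurent X -> laurent Y -> laurent Z ->
  Z ** (fun k => X k - Y k) = (fun k => (Z ** X) k - (Z ** Y) k).
Proof.
move=> lX lY lZ; apply/funext => k; rewrite /smul -fsumB; try exact: finite_smul.
by apply: eq_fsbigr => h _; rewrite mulmxBr.
Qed.

Definition binom (a b : int) (M M' : 'M[S]_n) : int -> 'M[S]_n :=
  fun k => mono a M k - mono b M' k.

Lemma laurent_binom a b (M M' : 'M[S]_n) : laurent (binom a b M M').
Proof. exact/laurentB. Qed.

Lemma binom_smulE a b (M M' : 'M[S]_n) X k : laurent X ->
  (binom a b M M' ** X) k = M *m X (k - a) - M' *m X (k - b).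
Proof. by move=> lX; rewrite smulBl// !mono_smulE. Qed.

Lemma binomM a b c d (M M' L L' : 'M[S]_n) :
  binom a b M M' ** binom c d L L' = fun k =>
  (mono (a + c) (M *m L) k - mono (a + d) (M *m L') k) -
  (mono (b + c) (M' *m L) k - mono (b + d) (M' *m L') k).
Proof.
apply/funext => k; rewrite binom_smulE /binom; last exact: laurent_binom.
have E (x y : int) (L1 L2 : 'M[S]_n) : L1 *m mono x L2 (k - y) = mono (y + x) (L1 *m L2) k.
  rewrite /mono (_ : (k - y == x) = (k == y + x)); last by lia.
  by case: ifP; rewrite ?mulmx0.
by rewrite !mulmxBr !E.
Qed.

(* The lowest coefficient of X survives, shifted by -4, in
   (c - z^4 - z^-4) X. *)
Lemma laurent_rec4 X (c : S) : laurent X ->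
  (forall k, c *: X k - X (k - 4) - X (k + 4) = 0) -> X = fun=> 0.
Proof.
move=> [m Xm] rec; have Xrec k : X (k + 4) = c *: X k - X (k - 4).
  by apply/eqP; rewrite eq_sym -subr_eq0 rec.
have X0 (p : nat) : forall k, k < m + p%:Z -> X k = 0.
  elim: p => [k|p IH k kp]; first by rewrite addr0; exact: Xm.
  rewrite -[k](subrK 4) Xrec !IH ?scaler0 ?subrr//; lia.
apply/funext => k; apply: (X0 (`|k - m|%N.+1)); lia.
Qed.

End Differences.
#[export] Hint Resolve laurent_binom : core.

Section Unitarity.
Variables (C : fieldType) (N : nat) (q : C).
Hypothesis q0 : q != 0.
Local Notation h := (q - q^-1).
Local Notation P := (Pmx C N).
Local Notation Ap := (Rser N q 1).
Local Notation Am := (- Rser N q (-1)).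

Lemma Rser_binom : Rser N q = binom 1 (-1) Ap Am.
Proof.
apply/funext => k; rewrite /binom /mono.
have [->|k1] := eqVneq k 1; first by rewrite subr0.
have [->|kN1] := eqVneq k (-1); first by rewrite opprK add0r.
by rewrite Rser_support// subr0.
Qed.

(* R(z^2) and R(z^-2) *)
Definition Rsq : int -> 'M[C]_(N * N) := subst (A := C^o) 1 (2 : int) (Rser N q).
Definition Rsqinv : int -> 'M[C]_(N * N) :=
  subst (A := C^o) 1 (- 2 : int) (Rser N q).

Lemma subst_binom (e : int) (M M' : 'M[C]_(N * N)) : e != 0 ->
  subst (A := C^o) 1 e (binom 1 (-1) M M') = binom e (- e) M M'.
Proof.
move=> e0; apply/esym/subst_ext => [|k|g ge]; first exact: mulrz_intI.
  rewrite exp1rz scalemx_alg1 /binom /mono mulrzz.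
  have -> : (e * k == e) = (k == 1) by rewrite -(inj_eq (mulfI e0) k 1) mulr1.
  by have -> : (e * k == - e) = (k == -1) by rewrite -(inj_eq (mulfI e0) k (-1)) mulrN1.
rewrite /binom /mono; case: eqP => [E|_].
  by case: (ge 1); rewrite mulrzz mulr1.
case: eqP => [E|_]; last by rewrite subrr.
by case: (ge (-1)); rewrite mulrzz mulrN1.
Qed.

Lemma RsqE : Rsq = binom 2 (-2) Ap Am.
Proof. by rewrite /Rsq {1}Rser_binom subst_binom. Qed.

Lemma swap_RsqinvE : swap Rsqinv = binom (-2) 2 (P *m Ap *m P) (P *m Am *m P).
Proof.
rewrite /Rsqinv {1}Rser_binom subst_binom// opprK; apply/funext => k.
rewrite /swap /binom /mono mulmxBr mulmxBl.
by do 2![case: ifP => _]; rewrite ?mulmx0 ?mul0mx.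
Qed.

Lemma laurent_Rsq : laurent Rsq.
Proof. by rewrite RsqE. Qed.

Lemma laurent_swap_Rsqinv : laurent (swap Rsqinv).
Proof. by rewrite swap_RsqinvE. Qed.

(** The scalar a(z^2) a(z^-2) = q^2 + q^-2 - z^4 - z^-4, as a series of scalar matrices. *)
Definition unit_scalar : int -> 'M[C]_(N * N) := fun k =>
  mono 0 (q ^+ 2 + q^-1 ^+ 2)%:M k - mono 4 1%:M k - mono (-4) 1%:M k.

(** The Hecke relation says that c - h is the inverse of c, and then c^2 + c^-2 = 2 + h^2 with h = q
    - q^-1. *)
Lemma hecke_unit (c : 'M[C]_(N * N)) : c *m c = h *: c + 1%:M ->
  [/\ c *m (c - h%:M) = 1%:M, (c - h%:M) *m c = 1%:M &
      c *m c + (c - h%:M) *m (c - h%:M) = (q ^+ 2 + q^-1 ^+ 2)%:M].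
Proof.
move=> cc.
have E1 : c *m (c - h%:M) = 1%:M.
  by rewrite mulmxBr cc mul_mx_scalar addrC addKr.
have E2 : (c - h%:M) *m c = 1%:M.
  by rewrite mulmxBl cc mul_scalar_mx addrC addKr.
split=> //; rewrite [in X in _ + X]mulmxBr E2 cc mul_mx_scalar.
rewrite scalerBr scale_scalar_mx opprB -addrA (addrCA _ 1%:M) addrCA.
rewrite [LHS]addrC -!addrA addNr addr0 -!raddfD /=; congr (_%:M).
by field.
Qed.

Lemma AmE : Am = Ap - h *: P.
Proof.
rewrite -(Rser_sum1 N q); move: (Rser N q 1) (Rser N q (-1)) => a b.
by rewrite opprD addNKr.
Qed.

(** The Hecke relation of Ap P conjugated by P. The two versions serve the two orders of the product
    of R_12 and R_21. *)
Lemma hecke_l : (P *m Ap) *m (P *m Ap) = h *: (P *m Ap) + 1%:M.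
Proof.
have := congr1 (fun M => P *m M *m P) (@Rser_hecke C N q q0).
rewrite mulmxDr mulmxDl -scalemxAr -scalemxAl mulmx1 PmxK !mulmxA.
by rewrite -!(mulmxA _ P P) PmxK !mulmx1.
Qed.

(** In (z^a M - z^-a M')(z^-a L - z^a L') the degree-0 part is c^2 + c^-2 and both cross terms are
    1, which leaves c^2 + c^-2 - z^4 - z^-4 for a = 2 or -2. *)
Lemma unitarity (c : 'M[C]_(N * N)) (X Y : int -> 'M[C]_(N * N)) M M' L L' a :
  c *m c = h *: c + 1%:M ->
  M *m L = c *m c -> M' *m L' = (c - h%:M) *m (c - h%:M) ->
  M *m L' = c *m (c - h%:M) -> M' *m L = (c - h%:M) *m c ->
  (a == 2) || (a == -2) ->
  X = binom a (- a) M M' -> Y = binom (- a) a L L' ->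
  X ** Y = unit_scalar.
Proof.
move=> /hecke_unit[E1 E2 E3] ML M'L' ML' M'L ha -> ->.
rewrite binomM ML M'L' ML' M'L E1 E2 subrr addNr.
apply/funext => k; rewrite /unit_scalar -E3 /mono opprB addrACA.
have -> : (if k == 0 then c *m c + (c - h%:M) *m (c - h%:M) else 0) =
  (if k == 0 then c *m c else 0) +
  (if k == 0 then (c - h%:M) *m (c - h%:M) else 0).
  by case: ifP; rewrite ?addr0.
rewrite -[RHS]addrA; congr (_ + _); case/orP: ha => /eqP -> //.
by rewrite addrC.
Qed.

Lemma swap_Rsqinv_Rsq : swap Rsqinv ** Rsq = unit_scalar.
Proof.
have AmP : P *m Am = P *m Ap - h%:M.
  by rewrite AmE mulmxBr -scalemxAr PmxK scalemx1.
apply: (unitarity (c := P *m Ap) (a := -2) hecke_l _ _ _ _ _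
  swap_RsqinvE RsqE) => //.
- by rewrite mulmxA.
- by rewrite -AmP mulmxA.
- by rewrite -AmP mulmxA.
- by rewrite -AmP mulmxA.
Qed.

Lemma Rsq_swap_Rsqinv : Rsq ** swap Rsqinv = unit_scalar.
Proof.
have AmP : Am *m P = Ap *m P - h%:M.
  by rewrite AmE mulmxBl -scalemxAl PmxK scalemx1.
apply: (unitarity (c := Ap *m P) (a := 2) (@Rser_hecke C N q q0) _ _ _ _ _
  RsqE swap_RsqinvE) => //.
- by rewrite !mulmxA.
- by rewrite -AmP !mulmxA.
- by rewrite -AmP !mulmxA.
- by rewrite -AmP !mulmxA.
Qed.

Variable A : algType C.

Lemma emb_unit_scalarE : emb A unit_scalar = fun k => mono 0 ((q ^+ 2 + q^-1 ^+ 2)%:A)%:M k -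
    mono 4 1%:M k - mono (-4) 1%:M k.
Proof.
apply/funext => l; rewrite /emb /unit_scalar /mono !map_mxB.
by do 3!case: ifP => _; rewrite ?map_mx0 ?map_scalar_mx /= ?scale1r.
Qed.

Lemma emb_unit_scalar_smull X k : laurent X ->
  (emb A unit_scalar ** X) k =
  ((q ^+ 2 + q^-1 ^+ 2)%:A) *: X k - X (k - 4) - X (k + 4).
Proof.
move=> lX.
rewrite emb_unit_scalarE.
rewrite (@smulBl _ _ (fun k => mono 0 _ k - mono 4 1%:M k))//; last exact: laurentB.
rewrite smulBl// !mono_smulE !mul1mx mul_scalar_mx subr0.
by congr (_ - X _); lia.
Qed.

Lemma emb_unit_scalar_smulr X k : laurent X ->
  (X ** emb A unit_scalar) k =
  ((q ^+ 2 + q^-1 ^+ 2)%:A) *: X k - X (k - 4) - X (k + 4).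
Proof.
move=> lX.
rewrite emb_unit_scalarE.
rewrite (@smulBr _ _ (fun k => mono 0 _ k - mono 4 1%:M k))//; last exact: laurentB.
rewrite smulBr// !smul_monoE !mulmx1 -scalemx1 mulmx_algr mulmx1 subr0.
by congr (_ - X _); lia.
Qed.

(* Multiplying by R(z^-2) on both sides gives the claim up to the factor
   a(z^2) a(z^-2), which is not a zero divisor. *)
Lemma exchange_Rsqinv (Z Z' : int -> 'M[A]_(N * N)) : laurent Z -> laurent Z' ->
  emb A Rsq ** Z = Z' ** emb A Rsq ->
  Z ** emb A (swap Rsqinv) = emb A (swap Rsqinv) ** Z'.
Proof.
move=> lZ lZ' E; set w := emb A (swap Rsqinv); set r := emb A Rsq in E *.
have lw : laurent w by exact/laurent_emb/laurent_swap_Rsqinv.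
have lr : laurent r by exact/laurent_emb/laurent_Rsq.
have wr : w ** r = emb A unit_scalar.
  by rewrite -emb_smul ?swap_Rsqinv_Rsq//;
    [exact: laurent_swap_Rsqinv | exact: laurent_Rsq].
have rw : r ** w = emb A unit_scalar.
  by rewrite -emb_smul ?Rsq_swap_Rsqinv//;
    [exact: laurent_Rsq | exact: laurent_swap_Rsqinv].
have lf : laurent (emb A unit_scalar) by rewrite -wr.
have fE : emb A unit_scalar ** (Z ** w) = (w ** Z') ** emb A unit_scalar.
  rewrite -{1}wr -rw -!smulA//; congr (w ** _).
  by rewrite !smulA// E.
pose D k := (Z ** w) k - (w ** Z') k.
have D0 : D = fun=> 0.
  apply: (@laurent_rec4 _ _ _ ((q ^+ 2 + q^-1 ^+ 2)%:A)).
    exact: laurentB.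
  move=> k; rewrite -emb_unit_scalar_smull; last exact: laurentB.
  rewrite smulBr// fE emb_unit_scalar_smulr// emb_unit_scalar_smull//.
  by rewrite subrr.
apply/funext => k; apply/eqP; rewrite -subr_eq0; apply/eqP.
exact: (congr1 (fun F => F k) D0).
Qed.

End Unitarity.

(** * Inverses and the RTT relation *)

Section Inverses.
Variable S : pzRingType.

Definition two_sided (n : nat) (M M' : 'M[S]_n) : Prop :=
  M *m M' = 1%:M /\ M' *m M = 1%:M.

Lemma block_mx_eq1 n (a : 'M[S]_1) b c (d : 'M[S]_n) :
  a = 1%:M -> b = 0 -> c = 0 -> d = 1%:M -> block_mx a b c d = 1%:M.
Proof. by move=> -> -> -> ->; rewrite -scalar_mx_block. Qed.

(** Entries do not commute, so determinants are of no use. Induction peels off the first row and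
    column: with a' and D' inverse to a and D, the block matrix with rows (a, r) and (0, D) has the
    inverse with rows (a', - a' r D') and (0, D'). *)
Lemma upper_triangular_inv n (M : 'M[S]_n) :
  (forall a b : 'I_n, (a < b)%N -> M b a = 0) ->
  (forall a, exists u, M a a * u = 1 /\ u * M a a = 1) ->
  exists M', two_sided M M'.
Proof.
elim: n M => [M _ _|n IH M M0 Mu].
  by exists 0; split; apply/matrixP => -[].
pose a : 'M[S]_1 := @ulsubmx _ 1 n 1 n M.
pose r := @ursubmx _ 1 n 1 n M; pose D := @drsubmx _ 1 n 1 n M.
have ME : M = @block_mx _ 1 n 1 n a r 0 D.
  have M0' : @dlsubmx _ 1 n 1 n M = 0.
    by apply/matrixP => i j; rewrite !mxE M0//= ord1.
  by rewrite -[LHS](@submxK _ 1 n 1 n) M0'.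
have [D' [DD' D'D]] : exists D', two_sided D D'.
  apply: IH => [i j ij|i]; first by rewrite !mxE; apply: M0.
  by rewrite !mxE; exact: Mu.
have [u [au ua]] := Mu ord0.
have aE : a = (M ord0 ord0)%:M.
  rewrite [LHS]mx11_scalar; congr (_%:M); rewrite !mxE.
  by congr (M _ _); apply: val_inj.
pose a' : 'M[S]_1 := u%:M.
have aa' : a *m a' = 1%:M by rewrite aE -scalar_mxM au.
have a'a : a' *m a = 1%:M by rewrite aE -scalar_mxM ua.
exists (@block_mx _ 1 n 1 n a' (- (a' *m r *m D')) 0 D').
split; rewrite ME (@mulmx_block _ 1 n 1 n 1 n) !(mul0mx, mulmx0, addr0, add0r);
  apply: block_mx_eq1; rewrite ?aa' ?a'a ?DD' ?D'D // ?mulmxN ?mulNmx ?mulmxA ?mulNmx ?DD' ?aa' ?mul1mx ?addNr ?addrN //.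
by rewrite -(mulmxA _ D') D'D mulmx1 addrN.
Qed.

Lemma lower_triangular_inv n (M : 'M[S]_n) :
  (forall a b : 'I_n, (a < b)%N -> M a b = 0) ->
  (forall a, exists u, M a a * u = 1 /\ u * M a a = 1) ->
  exists M', two_sided M M'.
Proof.
elim: n M => [M _ _|n IH M M0 Mu].
  by exists 0; split; apply/matrixP => -[].
pose a : 'M[S]_1 := @ulsubmx _ 1 n 1 n M.
pose r := @dlsubmx _ 1 n 1 n M; pose D := @drsubmx _ 1 n 1 n M.
have ME : M = @block_mx _ 1 n 1 n a 0 r D.
  have M0' : @ursubmx _ 1 n 1 n M = 0.
    by apply/matrixP => i j; rewrite !mxE M0//= ord1.
  by rewrite -[LHS](@submxK _ 1 n 1 n) M0'.
have [D' [DD' D'D]] : exists D', two_sided D D'.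
  apply: IH => [i j ij|i]; first by rewrite !mxE; apply: M0.
  by rewrite !mxE; exact: Mu.
have [u [au ua]] := Mu ord0.
have aE : a = (M ord0 ord0)%:M.
  rewrite [LHS]mx11_scalar; congr (_%:M); rewrite !mxE.
  by congr (M _ _); apply: val_inj.
pose a' : 'M[S]_1 := u%:M.
have aa' : a *m a' = 1%:M by rewrite aE -scalar_mxM au.
have a'a : a' *m a = 1%:M by rewrite aE -scalar_mxM ua.
exists (@block_mx _ 1 n 1 n a' 0 (- (D' *m r *m a')) D').
split; rewrite ME (@mulmx_block _ 1 n 1 n 1 n) !(mul0mx, mulmx0, addr0, add0r);
  apply: block_mx_eq1; rewrite ?aa' ?a'a ?DD' ?D'D // ?mulmxN ?mulNmx ?mulmxA ?mulNmx ?DD' ?aa' ?mul1mx ?addNr ?addrN //.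
by rewrite -(mulmxA _ a') a'a mulmx1 addNr.
Qed.

Variable n : nat.
Implicit Types X Y : int -> 'M[S]_n.

Lemma fsum_ord (V : nmodType) (f : int -> V) (p : nat) :
  (forall k, ~ (0 <= k <= p%:Z) -> f k = 0) ->
  \sum_(k \in [set: int]) f k = \sum_(l < p.+1) f l%:Z.
Proof.
move=> f0.
rewrite (@fsbig_ord _ 0 +%R p.+1 (fun l => f l%:Z)).
rewrite -(@fsbig_image _ 0 +%R _ _ `I_p.+1 (fun l : nat => l%:Z) f); last first.
  by move=> x y _ _ [].
apply/esym/fsbig_widen => // k [_ kp]; apply: f0 => k0p; apply: kp.
by exists `|k|%N => /=; lia.
Qed.

(** The recursion Y_p = U (delta_p0 - sum over j < p of X_(p-j) Y_j), where U inverts X_0. It calls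
    all earlier coefficients, hence the fuel; any fuel above [p] gives the same value. *)
Fixpoint sinv_coef (X : int -> 'M[S]_n) (U : 'M[S]_n) (fuel p : nat) : 'M[S]_n :=
  if fuel is f.+1 then
    U *m ((if p == 0%N then 1%:M else 0)
          - \sum_(j < p) X (p%:Z - j%:Z) *m sinv_coef X U f j)
  else 0.

Lemma sinv_coef_fuel X U f f' p : (p < f)%N -> (p < f')%N ->
  sinv_coef X U f p = sinv_coef X U f' p.
Proof.
elim: f f' p => [|f IH] [|f'] p //= pf pf'.
congr (_ *m (_ - _)); apply: eq_bigr => j _; congr (_ *m _).
by apply: IH; have := ltn_ord j; lia.
Qed.

Lemma series_right_inv X U :
  (forall k, k < 0 -> X k = 0) -> X 0 *m U = 1%:M ->
  exists Y, [/\ forall k, k < 0 -> Y k = 0, Y 0 = U & X ** Y = cst 1%:M].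
Proof.
move=> Xneg XU; pose y p := sinv_coef X U p.+1 p.
have yE p : y p = U *m ((if p == 0%N then 1%:M else 0)
    - \sum_(j < p) X (p%:Z - j%:Z) *m y j).
  rewrite {1}/y /=; congr (_ *m (_ - _)); apply: eq_bigr => j _.
  by congr (_ *m _); apply: sinv_coef_fuel.
pose Y (k : int) : 'M[S]_n := if k is Posz p then y p else 0.
exists Y; split => [[]//||].
  by rewrite /= yE big_ord0 subr0 mulmx1.
apply/funext => k; rewrite /smul (smul_rev X Y (fun a b => a *m b)) /cst.
case: k => [p|p]; last first.
  apply: fsbig1 => -[h|h] _; last by rewrite mulmx0.
  by rewrite Xneg ?mul0mx//; lia.
rewrite (@fsum_ord _ _ p) => [|k kp]; last first.
  have [k0|k0] := ltP k 0; first by case: k k0 {kp} => //= *; rewrite mulmx0.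
  by rewrite Xneg ?mul0mx//; lia.
(* The last term is X_0 times the p-th coefficient; X_0 U = 1 turns it into the wanted value minus
   the other terms. *)
rewrite big_ord_recr /= subrr yE mulmxA XU mul1mx.
by rewrite addrC subrK.
Qed.

(** The right inverse [Y] has constant term [U], so it has a right inverse [Z] of its own; then X =
    X Y Z = Z, and [Y] is two-sided. *)
Lemma is_sinv_of_const X U :
  (forall k, k < 0 -> X k = 0) -> two_sided (X 0) U -> exists Y, is_sinv X Y.
Proof.
move=> Xneg [XU UX]; have [Y [Yneg Y0 XY]] := series_right_inv Xneg XU.
have [Z [Zneg _ YZ]] : exists Z, [/\ forall k, k < 0 -> Z k = 0,
    Z 0 = X 0 & Y ** Z = cst 1%:M] by apply: series_right_inv; rewrite ?Y0.
have lX : laurent X by exists 0.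
have lY : laurent Y by exists 0.
have lZ : laurent Z by exists 0.
have XZ : X = Z by rewrite -[X]smuls1 -YZ smulA// XY smul1s.
by exists Y; split => //; rewrite XZ.
Qed.

Lemma sinvP X : (exists Y, is_sinv X Y) -> is_sinv X (sinv X).
Proof. by move=> [Y XY]; rewrite /sinv; case: xgetP => [_ -> //|/(_ Y)]. Qed.

Lemma is_sinv_smul X X' Y Y' : laurent X -> laurent X' ->
  is_sinv X Y -> is_sinv X' Y' -> is_sinv (X ** X') (Y' ** Y).
Proof.
move=> lX lX' [lY XY YX] [lY' XY' YX']; split => //.
  by rewrite -smulA// (smulL1 XY')// smul1s.
by rewrite -smulA// (smulL1 YX)// smul1s.
Qed.

Lemma is_sinv_one : is_sinv (cst 1%:M : int -> 'M[S]_n) (cst 1%:M).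
Proof. by split => //; rewrite smul1s. Qed.

(** [smul] is not a monoid law on all series, so the product over the copies is handled by induction
    on the list of indices. *)
Lemma big_smul_ind (I : Type) (r : seq I) (X : I -> int -> 'M[S]_n)
    (Q : (int -> 'M[S]_n) -> Prop) :
  Q (cst 1%:M) -> (forall x y, Q x -> Q y -> Q (x ** y)) ->
  (forall i, Q (X i)) -> Q (\big[@smul S int n/cst 1%:M]_(i <- r) X i).
Proof.
by move=> Q1 Qm QX; elim: r => [|i r IH]; rewrite ?big_nil// big_cons; apply: Qm.
Qed.

End Inverses.

Section Lseries.
Variables (S : pzRingType) (N : nat).
Implicit Types L : nat -> 'M[S]_N.

Lemma LserE (eps : int) L (p : nat) : eps != 0 ->
  Lser eps L (eps * (2 * p)%N%:Z) = L p.
Proof.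
move=> e0; rewrite /Lser (_ : [set n | _] = [set p]) ?fsbig_set1//.
apply/seteqP; split => n /= => [/(mulfI e0)|->]//.
by case; lia.
Qed.

Lemma Lser_cases (eps : int) L k : eps != 0 ->
  Lser eps L k = 0 \/ exists2 p : nat, k = eps * (2 * p)%N%:Z & Lser eps L k = L p.
Proof.
move=> e0; have [[p ->]|kp] := pselect (exists p : nat, k = eps * (2 * p)%N%:Z).
  by right; exists p; rewrite ?LserE.
by left; apply: fsbig1 => p /= E; case: kp; exists p.
Qed.

Lemma Lser1_neg L k : k < 0 -> Lser 1 L k = 0.
Proof.
by move=> k0; have [//|[p kE _]] := @Lser_cases 1 L k isT; rewrite kE in k0; lia.
Qed.

Lemma LserN1_pos L k : 0 < k -> Lser (-1) L k = 0.
Proof.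
by move=> k0; have [//|[p kE _]] := @Lser_cases (-1) L k isT; rewrite kE in k0; lia.
Qed.

Lemma Lser1_0 L : Lser 1 L 0 = L 0%N.
Proof. by have := @LserE 1 L 0 isT; rewrite mulr0. Qed.

Lemma laurent_Lser1 L : laurent (Lser 1 L).
Proof. by exists 0 => k; exact: Lser1_neg. Qed.

Lemma LserN1_opp L k : Lser (-1) L (- k) = Lser 1 L k.
Proof.
rewrite /Lser; apply: eq_fsbigl; apply/seteqP; split => p /=; lia.
Qed.

Lemma comm_Lser1 L L' : (forall p p', comm_entries (L p) (L' p')) ->
  forall h l, comm_entries (Lser 1 L h) (Lser 1 L' l).
Proof.
move=> LL' h l a b c d.
have [->|[p _ ->]] := @Lser_cases 1 L h isT.
  by rewrite mxE; exact/commr_sym/commr0.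
have [->|[p' _ ->]] := @Lser_cases 1 L' l isT; last exact: LL'.
by rewrite mxE; exact: commr0.
Qed.

End Lseries.

(** T^-(1/z) is the power series [Tser 1 L] in z. This brings T^- into the setting of Laurent
    series. *)
Lemma Tser_opp (C : fieldType) (A : algType C) N m (L : 'I_m -> nat -> 'M[A]_N) :
  subst 1 (- 1 : int) (Tser (-1) L) = Tser 1 L.
Proof.
rewrite /Tser; elim: (index_enum _) => [|i r IH].
  by rewrite !big_nil; have := @subst_mono _ A N 1 (-1) 0 1%:M isT;
     rewrite mulr0 expr0z scalemx_alg1.
rewrite !big_cons subst1N1_smul IH; congr (_ ** _).
by apply/funext => k; rewrite subst1N1E LserN1_opp.
Qed.

Section RTT.
Variables (S : pzRingType) (N : nat) (I : eqType).
Variables (X Y : I -> int -> 'M[S]_N) (r : int -> 'M[S]_(N * N)).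
Hypotheses (lX : forall i, laurent (X i)) (lY : forall i, laurent (Y i)).
Hypothesis lr : laurent r.
Hypothesis rXY : forall i, r ** sp1 (X i) ** sp2 (Y i) = sp2 (Y i) ** sp1 (X i) ** r.
Hypothesis XY : forall i j, i != j -> forall h l, comm_entries (X i h) (Y j l).

Local Notation prod Z s := (\big[@smul S int N/cst 1%:M]_(i <- s) Z i).

Lemma laurent_prod (Z : I -> int -> 'M[S]_N) s :
  (forall i, laurent (Z i)) -> laurent (prod Z s).
Proof.
by move=> lZ; apply: big_smul_ind => //; exact: laurent_smul.
Qed.

Lemma sp1_prod_comm i s : i \notin s ->
  sp1 (prod X s) ** sp2 (Y i) = sp2 (Y i) ** sp1 (prod X s).
Proof.
elim: s => [_|j s IH]; first by rewrite big_nil sp1_cst mx1_1 smul1s smuls1.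
rewrite inE negb_or => /andP[ij is_]; have lXs := laurent_prod s lX.
have ji : j != i by rewrite eq_sym.
have lXj := lX j; have lYi := lY i.
by rewrite big_cons sp1_smul// -smulA// IH// smulA// (sp12C (XY ji)) smulA.
Qed.

Lemma sp2_prod_comm i s : i \notin s ->
  sp1 (X i) ** sp2 (prod Y s) = sp2 (prod Y s) ** sp1 (X i).
Proof.
elim: s => [_|j s IH]; first by rewrite big_nil sp2_cst mx2_1 smul1s smuls1.
rewrite inE negb_or => /andP[ij is_]; have lYs := laurent_prod s lY.
have lXi := lX i; have lYj := lY j.
rewrite big_cons sp2_smul// smulA// (sp12C (XY ij)) -!smulA//.
by rewrite IH.
Qed.

(** [r] is carried through one copy at a time: letters of different copies and different legs
    commute, so Y_i can be brought next to X_i. Repeated indices are excluded because letters of the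
    same copy need not commute. *)
Lemma RTT_prod s : uniq s ->
  r ** sp1 (prod X s) ** sp2 (prod Y s) = sp2 (prod Y s) ** sp1 (prod X s) ** r.
Proof.
elim: s => [_|i s IH /= /andP[is_ us]].
  by rewrite !big_nil sp1_cst sp2_cst mx1_1 mx2_1 !smul1s !smuls1.
have lXs := laurent_prod s lX; have lYs := laurent_prod s lY.
have lXi := lX i; have lYi := lY i.
rewrite !big_cons sp1_smul// sp2_smul//.
set x := sp1 (X i); set y := sp2 (Y i).
set xs := sp1 (prod X s); set ys := sp2 (prod Y s).
have [lx ly lxs lys] : [/\ laurent x, laurent y, laurent xs & laurent ys].
  by rewrite /x /y /xs /ys; split.
transitivity (r ** x ** y ** (xs ** ys)).
  rewrite -!smulA//; congr (r ** (x ** _)); rewrite !smulA//.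
  by rewrite /xs /y sp1_prod_comm.
rewrite rXY -/x -/y -!smulA//.
have -> : r ** (xs ** ys) = ys ** (xs ** r) by rewrite !smulA// IH.
by rewrite (smulL (sp2_prod_comm is_)).
Qed.

End RTT.

(** * Passing to one variable *)

(** The specialization w = 1/z. It is legitimate because L^+(z) has exponents of z at least 0,
    L^-(w) exponents of w at most 0, and R(z/w) only the exponents 1 and -1. *)
Lemma RLL_one_variable (C : fieldType) (A : algType C) N (q : C)
    (L L' : nat -> 'M[A]_N) :
  RLL q (Lser 1 L) (Lser (-1) L') ->
  emb A (Rsq N q) ** sp1 (Lser 1 L) ** sp2 (Lser 1 L') =
  sp2 (Lser 1 L') ** sp1 (Lser 1 L) ** emb A (Rsq N q).
Proof.
have h1 : -1 = 1 :> int \/ -1 = -1 :> int by right.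
have i1 := @mulrz_pairI 1 (-1) isT.
have i2 := @mulrz_pairI 1 0 isT.
have i3 := @mulrz_pairI 0 1 isT.
rewrite /RLL (_ : ((1, 0) - (0, 1) : int * int) = (1, -1))//.
rewrite emb_subst// sp1_subst// sp2_subst//.
have qr : quad (-1) (subst 1 (1, -1) (emb A (Rser N q))).
  apply: (@quad_subst _ _ _ _ _ _ _ (-1)) => // k Rk.
  suff : (k == 1) || (k == -1) by lia.
  apply: contrapT => /negP; rewrite negb_or => /andP[k1 kN1].
  by apply: Rk; rewrite /emb Rser_support// map_mx0.
have qx : quad (-1) (subst 1 (1, 0) (sp1 (Lser 1 L))).
  apply: (@quad_subst _ _ _ _ _ _ _ 0) => // k Xk.
  suff : 0 <= k by lia.
  rewrite leNgt; apply/negP => k0.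
  by apply: Xk; rewrite /sp1 Lser1_neg// raddf0.
have qy : quad (-1) (subst 1 (0, 1) (sp2 (Lser (-1) L'))).
  apply: (@quad_subst _ _ _ _ _ _ _ 0) => // k Xk.
  suff : k <= 0 by lia.
  rewrite leNgt; apply/negP => k0.
  by apply: Xk; rewrite /sp2 LserN1_pos// raddf0.
have one0 : (1 : C) != 0 by exact: oner_neq0.
have [qrx qyx] := (quad_smul qr qx, quad_smul qy qx).
move=> /(congr1 (spec (-1) 1)); rewrite !spec_smul// !spec_subst//.
rewrite !exp1rz !mulr1 /= -emb_subst; last exact: mulrz_intI.
rewrite (_ : 1 + -1 * -1 = 2 :> int)// (_ : 1 + -1 * 0 = 1 :> int)//.
rewrite (_ : 0 + -1 * 1 = -1 :> int)// subst11 -sp2_subst; last exact: mulrz_intI.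
have -> : subst 1 (-1 : int) (Lser (-1) L') = Lser 1 L'.
  by apply/funext => k; rewrite subst1N1E LserN1_opp.
by [].
Qed.

Lemma spec_word4 (C : fieldType) (A : algType C) n (eps : int) (c : C)
    (F1 F2 F3 F4 G1 G2 G3 G4 : int * int -> 'M[A]_n) f1 f2 f3 f4 g1 g2 g3 g4 :
  eps = 1 \/ eps = -1 -> c != 0 ->
  quad eps F1 -> quad eps F2 -> quad eps F3 -> quad eps F4 ->
  quad eps G1 -> quad eps G2 -> quad eps G3 -> quad eps G4 ->
  spec eps c F1 = f1 -> spec eps c F2 = f2 -> spec eps c F3 = f3 ->
  spec eps c F4 = f4 -> spec eps c G1 = g1 -> spec eps c G2 = g2 ->
  spec eps c G3 = g3 -> spec eps c G4 = g4 ->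
  F1 ** F2 ** F3 ** F4 = G1 ** G2 ** G3 ** G4 ->
  f1 ** f2 ** f3 ** f4 = g1 ** g2 ** g3 ** g4.
Proof.
move=> he c0 qF1 qF2 qF3 qF4 qG1 qG2 qG3 qG4.
move=> <- <- <- <- <- <- <- <- E.
have [qF12 qG12] := (quad_smul qF1 qF2, quad_smul qG1 qG2).
have [qF qG] := (quad_smul qF12 qF3, quad_smul qG12 qG3).
by rewrite -!spec_smul// E.
Qed.

(** The specialization w = c z: the ratio z/w is the number 1/c, so the outer matrices become
    constants, and zw becomes c z^2. *)
Lemma reflection_specialized (C : fieldType) (A : algType C) N
    (r r' : int -> 'M[A]_(N * N)) (X Y : int -> 'M[A]_N) (c : C) :
  c != 0 -> laurent X -> laurent Y ->
  (forall k, r k <> 0 -> -1 <= k <= 1) -> (forall k, r' k <> 0 -> -1 <= k <= 1) ->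
  subst 1 ((1, 0) - (0, 1) : int * int) r ** sp1 (subst 1 ((1, 0) : int * int) X)
    ** subst 1 ((1, 0) + (0, 1) : int * int) r'
    ** sp2 (subst 1 ((0, 1) : int * int) Y) =
  sp2 (subst 1 ((0, 1) : int * int) Y) ** subst 1 ((1, 0) + (0, 1) : int * int) r
    ** sp1 (subst 1 ((1, 0) : int * int) X)
    ** subst 1 ((1, 0) - (0, 1) : int * int) r' ->
  cst (\sum_(k \in [set: int]) (c ^ (- k))%:A *: r k) ** sp1 X
    ** subst c (2 : int) r' ** sp2 (subst c (1 : int) Y) =
  sp2 (subst c (1 : int) Y) ** subst c (2 : int) r ** sp1 X
    ** cst (\sum_(k \in [set: int]) (c ^ (- k))%:A *: r' k).
Proof.
move=> c0 /laurentP[a Xa] /laurentP[b Yb] rs rs'.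
have h1 : 1 = 1 :> int \/ 1 = -1 :> int by left.
have i2 := @mulrz_pairI 1 0 isT.
have i3 := @mulrz_pairI 0 1 isT.
rewrite (_ : ((1, 0) - (0, 1) : int * int) = (1, -1))//.
rewrite (_ : ((1, 0) + (0, 1) : int * int) = (1, 1))//.
rewrite !sp1_subst// !sp2_subst//; last exact: mulrz_intI.
have quad_r (F : int -> 'M[A]_(N * N)) (d : int) :
    (forall k, F k <> 0 -> -1 <= k <= 1) -> d = 1 \/ d = -1 ->
    quad 1 (subst 1 (1, d) F).
  move=> Fs hd; apply: (@quad_subst _ _ _ _ _ _ _ (-1)) => // k /Fs.
  by case: hd => ->; lia.
have qr1 : quad 1 (subst 1 (1, -1) r) by apply: quad_r => //; right.
have qr2 : quad 1 (subst 1 (1, 1) r) by apply: quad_r => //; left.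
have qs1 : quad 1 (subst 1 (1, -1) r') by apply: quad_r => //; right.
have qs2 : quad 1 (subst 1 (1, 1) r') by apply: quad_r => //; left.
have qx : quad 1 (subst 1 (1, 0) (sp1 X)).
  apply: (@quad_subst _ _ _ _ _ _ _ (- `|a|)) => // k Xk.
  suff /Xa : X k <> 0 by lia.
  by move=> E; apply: Xk; rewrite /sp1 E raddf0.
have qy : quad 1 (subst 1 (0, 1) (sp2 Y)).
  apply: (@quad_subst _ _ _ _ _ _ _ (- `|b|)) => // k Yk.
  suff /Yb : Y k <> 0 by lia.
  by move=> E; apply: Yk; rewrite /sp2 E raddf0.
have one0 : (1 : C) != 0 by exact: oner_neq0.
have e1 : spec 1 c (subst 1 (1, -1) r) = _ := spec_subst_ratio r c0.
have e2 : spec 1 c (subst 1 (1, -1) r') = _ := spec_subst_ratio r' c0.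
have e3 : spec 1 c (subst 1 (1, 1) r) = subst c (2 : int) r.
  by rewrite spec_subst// expr1z mul1r.
have e4 : spec 1 c (subst 1 (1, 1) r') = subst c (2 : int) r'.
  by rewrite spec_subst// expr1z mul1r.
have e5 : spec 1 c (subst 1 (1, 0) (sp1 X)) = sp1 X.
  by rewrite spec_subst// expr0z mulr1 mulr0 subst11.
have e6 : spec 1 c (subst 1 (0, 1) (sp2 Y)) = subst c (1 : int) (sp2 Y).
  by rewrite spec_subst// expr1z mul1r.
exact: (spec_word4 h1 c0 qr1 qx qs2 qy qy qr2 qx qs1 e1 e5 e4 e6 e6 e3 e5 e2).
Qed.

Lemma refl_eq_specialized (C : fieldType) N (r : int -> 'M[C]_(N * N))
    (X Y : int -> 'M[C]_N) (c : C) :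
  c != 0 -> laurent X -> laurent Y -> (forall k, r k <> 0 -> -1 <= k <= 1) ->
  refl_eq r X Y ->
  cst (\sum_(k \in [set: int]) c ^ (- k) *: r k) ** sp1 X
    ** subst (A := C^o) c (2 : int) (swap r)
    ** sp2 (subst (A := C^o) c (1 : int) Y) =
  sp2 (subst (A := C^o) c (1 : int) Y) ** subst (A := C^o) c (2 : int) r ** sp1 X
    ** cst (\sum_(k \in [set: int]) c ^ (- k) *: swap r k).
Proof.
move=> c0 lX lY rs rE.
have rs' k : swap r k <> 0 -> -1 <= k <= 1.
  by move=> rk; apply: rs => E; apply: rk; rewrite /swap E mulmx0 mul0mx.
have sumE (F : int -> 'M[C]_(N * N)) :
    \sum_(k \in [set: int]) c ^ (- k) *: F k =
    \sum_(k \in [set: int])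
      ((c ^ (- k))%:A : C^o) *: (F k : 'M[C^o]_(N * N)).
  by apply: eq_fsbigr => k _; congr (_ *: _); rewrite [RHS]mulr1.
rewrite (sumE r) (sumE (swap r)).
exact: (@reflection_specialized C C^o N r (swap r) X Y c c0 lX lY rs rs' rE).
Qed.

(** In the first word the exchange relations bring That next to T2, and Q absorbs them. What remains
    is Q Kb Rb21 K2 = Y VV followed by Mh Mi VV, with no Q before VV. The second form of [Y] gives Y
    = Y Q and supplies that Q; for the second word the first form gives Y = Q Y. *)
Lemma contraction_chain (S : pzRingType) n
    (Q That Kb Mh Rb21 T2 K2 Mi VV Rb12 Y : int -> 'M[S]_n) :
  [/\ laurent Q, laurent That, laurent Kb, laurent Mh & laurent Rb21] ->
  [/\ laurent T2, laurent K2, laurent Mi, laurent VV & laurent Rb12] ->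
  Mh ** Rb21 ** T2 = T2 ** Rb21 ** Mh ->
  That ** Rb12 ** Mi = Mi ** Rb12 ** That ->
  Kb ** T2 = T2 ** Kb -> Mh ** K2 = K2 ** Mh ->
  That ** K2 = K2 ** That -> Kb ** Mi = Mi ** Kb ->
  Q ** That ** T2 = Q -> Q ** VV ** Mh ** Mi ** VV = Q ->
  Mi ** Mh ** VV ** Q = VV ** Q -> T2 ** That ** Q = Q ->
  Y = Q ** Kb ** Rb21 ** K2 ** VV -> Y = K2 ** Rb12 ** Kb ** VV ** Q ->
  VV ** VV = cst 1%:M -> Q ** Q = Q ->
  Q ** (That ** Kb ** Mh) ** Rb21 ** (T2 ** K2 ** Mi) ** VV = Y /\
  T2 ** K2 ** Mi ** Rb12 ** (That ** Kb ** Mh) ** VV ** Q = Y.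
Proof.
move=> [lQ lTh lKb lMh lR21] [lT2 lK2 lMi lVV lR12] E1 E2 C1 C2 C3 C4 G1 G2 G3 G4.
move=> Y1 Y2 VV1 QQ.
have YVV : Q ** Kb ** Rb21 ** K2 = Y ** VV by rewrite Y1 -[RHS]smulA// VV1 smuls1.
have YQ : Y ** Q = Y by rewrite Y2 -[LHS]smulA// QQ.
have QY : Q ** Y = Y by rewrite Y1 -!smulA// (smulL1 QQ).
have lY : laurent Y by rewrite Y1.
split.
  transitivity (Q ** That ** (Kb ** T2) ** Rb21 ** (Mh ** K2) ** Mi ** VV).
    rewrite -!smulA//; congr (Q ** (That ** (Kb ** _))).
    by rewrite !smulA// E1.
  rewrite C1 C2.
  transitivity (Q ** That ** T2 ** (Kb ** (Rb21 ** (K2 ** (Mh ** (Mi ** VV)))))).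
    by rewrite -!smulA.
  rewrite G1.
  transitivity (Q ** Kb ** Rb21 ** K2 ** (Mh ** (Mi ** VV))); first by rewrite -!smulA.
  rewrite YVV -[in LHS]YQ.
  transitivity (Y ** (Q ** VV ** Mh ** Mi ** VV)); first by rewrite -!smulA.
  by rewrite G2.
transitivity (T2 ** (K2 ** That) ** Rb12 ** (Mi ** Kb) ** Mh ** VV ** Q).
  rewrite -!smulA//; congr (T2 ** (K2 ** _)).
  by rewrite !smulA// E2.
rewrite -C3 -C4.
transitivity (T2 ** That ** K2 ** Rb12 ** Kb ** (Mi ** Mh ** VV ** Q)).
  by rewrite -!smulA.
rewrite G3.
transitivity (T2 ** That ** (K2 ** Rb12 ** Kb ** VV ** Q)); first by rewrite -!smulA.
rewrite -Y2 -[in LHS]QY.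
transitivity (T2 ** That ** Q ** Y); first by rewrite -!smulA.
by rewrite G4.
Qed.

(** * The matrix Rbar, the projector Q and the contraction of the scalar pair *)

Section SpectralRMatrix.
Variables (C : fieldType) (N : nat) (q rho : C) (V : 'M[C]_N).
Hypotheses (rho0 : rho != 0) (VV1 : V *m V = 1%:M).
Hypothesis Vrev : forall a b, b != rev_ord a -> V a b = 0.
Local Notation P := (Pmx C N).
Local Notation V1 := (mx1 V).
Local Notation V2 := (mx2 V).

Lemma regular_alg (c : C) : c *: (1 : C^o) = c.
Proof. exact: mulr1. Qed.

(* R(z^-2 rho^-2) *)
Definition Rtwist : int -> 'M[C]_(N * N) :=
  subst (A := C^o) rho (1 : int) (Rsqinv N q).

(** Transfers identities that are linear in the coefficients of R to the rescaled series. *)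
Lemma Rtwist_cases k : exists c j, Rtwist k = c *: Rser N q j.
Proof.
have E : Rtwist k = rho ^ k *: Rsqinv N q k.
  by rewrite /Rtwist (@subst1E _ C^o); congr (_ *: _); exact: mulr1.
rewrite E /Rsqinv.
have inj := @mulrz_intI (-2) isT.
have [[j <-]|kj] := pselect (exists j : int, (-2) *~ j = k).
  rewrite (@subst_on _ C^o)// exp1rz (@scalemx_alg1 _ C^o).
  by exists (rho ^ (-2 *~ j)), j.
exists 0, 0; rewrite (@subst_off _ C^o) ?scaler0 ?scale0r// => j jk.
by apply: kj; exists j.
Qed.

Lemma Rtwist_tr k : P *m Rtwist k *m P = (Rtwist k)^T.
Proof.
have [c [j ->]] := Rtwist_cases k.
by rewrite -scalemxAr -scalemxAl Rser_tr; apply/matrixP => a b; rewrite !mxE.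
Qed.

Lemma Rtwist_VV k : V1 *m V2 *m Rtwist k = P *m Rtwist k *m P *m (V1 *m V2).
Proof.
have [c [j ->]] := Rtwist_cases k.
by rewrite -!scalemxAr -!scalemxAl Rser_VV.
Qed.

Lemma V1V1 : V1 *m V1 = 1%:M. Proof. by rewrite -mx1M VV1 mx1_1. Qed.
Lemma V2V2 : V2 *m V2 = 1%:M. Proof. by rewrite -mx2M VV1 mx2_1. Qed.
Lemma V1V2 : V1 *m V2 = V2 *m V1.
Proof. by apply: mx12C => a b c d; rewrite /GRing.comm mulrC. Qed.

Lemma central_com m n (M : 'M[C]_(m, n)) : central_mx M.
Proof. by move=> i j a; rewrite /GRing.comm mulrC. Qed.

Lemma Pmx_trmx2 (M : 'M[C]_(N * N)) : P *m trmx2 M *m P = ptrmx1 (P *m M *m P).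
Proof.
by apply: tens_matrixP => *; rewrite mul_Pmxr mul_Pmxl trmx2E ptrmx1E mul_Pmxr mul_Pmxl.
Qed.

(** R_21 = R^t gives R^{t_2} = R_21^{t_1}, and $t_1$ is the transposition that the exchange
    relations produce. *)
Lemma Rbar12 k : V1 *m trmx2 (Rtwist k) *m V1 = V1 *m ptrmx1 (P *m Rtwist k *m P) *m V1.
Proof. by rewrite Rtwist_tr ptrmx1_tr. Qed.

(* Conjugation by V (x) V exchanges the two tensor factors of R. *)
Lemma Rbar21 k : P *m (V1 *m trmx2 (Rtwist k) *m V1) *m P =
  mx1 V^T *m ptrmx1 (Rtwist k) *m mx1 V^T.
Proof.
set r := Rtwist k.
have PV1 : P *m V1 = V2 *m P by exact: Pmx_mx1.
have V1P : V1 *m P = P *m V2 by rewrite Pmx_mx2.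
have -> : P *m (V1 *m trmx2 r *m V1) *m P = V2 *m (P *m trmx2 r *m P) *m V2.
  by rewrite !mulmxA PV1 -!mulmxA V1P !mulmxA.
rewrite Pmx_trmx2 -ptrmx1_mx2l -ptrmx1_mx2r.
rewrite -ptrmx1_mx1r; last exact: central_com.
rewrite -ptrmx1_mx1l; last exact: central_com.
congr ptrmx1.
have -> : P *m r *m P = V1 *m V2 *m r *m (V2 *m V1).
  by rewrite Rtwist_VV -!mulmxA (mulmxA V2 V2) V2V2 mul1mx V1V1 mulmx1 !mulmxA.
have L : V2 *m (V1 *m V2) = V1 by rewrite V1V2 mulmxA V2V2 mul1mx.
by rewrite -!mulmxA L (mulmxA V1 V2) (mulmxA V2 (V1 *m V2)) L.
Qed.

Lemma trmx2_0 : trmx2 (0 : 'M[C]_(N * N)) = 0.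
Proof. by apply: tens_matrixP => *; rewrite trmx2E !mxE. Qed.

Lemma trmx2Z (a : C) (M : 'M[C]_(N * N)) : trmx2 (a *: M) = a *: trmx2 M.
Proof. by apply: tens_matrixP => *; rewrite [RHS]mxE !trmx2E mxE. Qed.

(** Inverting z^2 rho and multiplying by rho^-1 gives z^-2 rho^-2, the argument of [Rtwist]. *)
Lemma subst_RbarE :
  subst (A := C^o) rho (2 : int) (Rbar q rho V) =
  fun k => V1 *m trmx2 (Rtwist k) *m V1.
Proof.
have inj2 := @mulrz_intI 2 isT; have injN2 := @mulrz_intI (-2) isT.
apply/esym/(@subst_ext _ C^o) => // [k|k kj].
  rewrite /Rbar (@substN1E _ C^o) /Rtwist (@subst1E _ C^o) !regular_alg /Rsqinv.
  rewrite (_ : 2 *~ k = (-2) *~ (- k)); last by rewrite !mulrzz; lia.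
  rewrite (@subst_on _ C^o)// exp1rz (@scalemx_alg1 _ C^o).
  rewrite !trmx2Z -!scalemxAr -!scalemxAl scalerA; congr (_ *: _).
  rewrite exprz_inv -expfzDr//; congr (_ ^ _); rewrite mulrzz; lia.
rewrite /Rtwist (@subst1E _ C^o) /Rsqinv (@subst_off _ C^o)// => [|j jk].
  by rewrite scaler0 trmx2_0 mulmx0 mul0mx.
by apply: (kj (- j)); rewrite -jk !mulrzz; lia.
Qed.

Lemma swap_subst_RbarE :
  subst (A := C^o) rho (2 : int) (swap (Rbar q rho V)) =
  fun k => P *m (V1 *m trmx2 (Rtwist k) *m V1) *m P.
Proof. by rewrite -(@swap_subst _ C^o)// subst_RbarE. Qed.

Lemma Rbar_support k : Rbar q rho V k <> 0 -> -1 <= k <= 1.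
Proof.
move=> Rk; suff : (k == 1) || (k == -1) by lia.
apply: contrapT => /negP; rewrite negb_or => /andP[k1 kN1]; apply: Rk.
have [k1' kN1'] : - k != 1 /\ - k != -1 by split; lia.
rewrite /Rbar (@substN1E _ C^o) Rser_support//.
by rewrite scaler0 trmx2_0 mulmx0 mul0mx.
Qed.
Lemma fsum_binom n a b (M M' : 'M[C]_n) :
  \sum_(k \in [set: int]) binom a b M M' k = M - M'.
Proof.
have fin (c : int) (L : 'M[C]_n) : finite_set (mono c L @^-1` [set~ 0]).
  apply: (@finite_int1 _ _ c c) => k; rewrite /mono.
  by case: eqP => [->|//]; rewrite lexx.
rewrite /binom fsumB//; congr (_ - _).
  by rewrite (fsum_single (a := a)) /mono ?eqxx// => x /negPf ->.
by rewrite (fsum_single (a := b)) /mono ?eqxx// => x /negPf ->.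
Qed.

(** Explains the factor V_1 V_2 in the contraction: the specialized reflection equation has Q_21 on
    the right, and this factor turns it into Q_12. It holds because P^{t_2} is invariant under
    exchange of the legs. *)
Lemma Qmx_swap : P *m Qmx V *m P *m (V1 *m V2) = V1 *m V2 *m Qmx V.
Proof.
rewrite /Qmx -/(Kmx C N) -!scalemxAr -!scalemxAl; congr (_ *: _).
have PV1 : P *m V1 = V2 *m P by exact: Pmx_mx1.
have V1P : V1 *m P = P *m V2 by rewrite Pmx_mx2.
have -> : P *m (V1 *m Kmx C N *m V1) *m P = V2 *m (P *m Kmx C N *m P) *m V2.
  by rewrite !mulmxA PV1 -!mulmxA V1P !mulmxA.
rewrite Pmx_Kmx Kmx_Pmx V1V2 -!mulmxA; congr (V2 *m _).
by rewrite !mulmxA -(mulmxA _ V2 V2) V2V2 mulmx1 V1V1 mul1mx.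
Qed.

Hypothesis N0 : N%:R != 0 :> C.

(** The left side is Rbar(rho^-1). The powers of rho cancel and leave V_1 R(1)^{t_2} V_1, with R(1)
    = (q - q^-1) P. *)
Lemma sum_Rbar :
  \sum_(k \in [set: int]) rho ^ (- k) *: Rbar q rho V k =
  ((q - q^-1) * N%:R) *: Qmx V.
Proof.
pose f (M : 'M[C]_(N * N)) := V1 *m trmx2 M *m V1.
have fB M M' : f (M - M') = f M - f M'.
  rewrite /f -mulmxBl -mulmxBr; congr (_ *m _ *m _).
  by apply: tens_matrixP => *; rewrite trmx2E [LHS]mxE [X in _ + X = _]mxE [RHS]mxE
    [X in _ = _ + X]mxE !trmx2E.
transitivity (\sum_(k \in [set: int])
    binom (-1) 1 (f (Rser N q 1)) (f (- Rser N q (-1))) k).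
  apply: eq_fsbigr => k _; rewrite /Rbar (@substN1E _ C^o) regular_alg.
  rewrite trmx2Z -scalemxAr -scalemxAl scalerA exprz_inv -expfzDr// subrr.
  have -> : Rser N q (- k) = binom 1 (-1) (Rser N q 1) (- Rser N q (-1)) (- k).
    by rewrite -Rser_binom.
  rewrite expr0z scale1r -/(f _) /binom /mono fB.
  rewrite eqr_oppLR [- k == -1]eqr_opp.
  have f0 : f 0 = 0 by rewrite /f trmx2_0 mulmx0 mul0mx.
  by congr (_ - _); case: ifP.
rewrite fsum_binom -fB opprK Rser_sum1 /f trmx2Z /Qmx scalerA.
by rewrite mulfK// -scalemxAr -scalemxAl.
Qed.

Lemma sum_swap_Rbar :
  \sum_(k \in [set: int]) rho ^ (- k) *: swap (Rbar q rho V) k =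
  ((q - q^-1) * N%:R) *: (P *m Qmx V *m P).
Proof.
have fin : finite_set ((fun k => rho ^ (- k) *: Rbar q rho V k) @^-1` [set~ 0]).
  apply: (@finite_int1 _ _ (-1) 1) => k Rk; apply: Rbar_support => E.
  by apply: Rk; rewrite E scaler0.
rewrite -mulmxA scalemxAr scalemxAl -sum_Rbar.
rewrite -[X in P *m X]/(mulmxr P _) fsum_raddf// -[RHS]/(mulmx P _) fsum_raddf.
  apply: eq_fsbigr => k _; rewrite /= /swap.
  by rewrite -scalemxAl -scalemxAr [in RHS]mulmxA.
apply: (@finite_int1 _ (fun k : int => rho ^ (- k) *: Rbar q rho V k *m P) (-1) 1).
move=> k Rk; apply: Rbar_support => E.
by apply: Rk; rewrite E scaler0 mul0mx.
Qed.

Lemma QmxK : Qmx V *m Qmx V = Qmx V.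
Proof.
rewrite /Qmx -/(Kmx C N) -scalemxAl -scalemxAr; congr (_ *: _).
have -> : V1 *m Kmx C N *m V1 *m (V1 *m Kmx C N *m V1) =
    V1 *m (Kmx C N *m 1%:M *m Kmx C N) *m V1.
  by rewrite mulmx1 !mulmxA -(mulmxA _ V1 V1) V1V1 mulmx1.
rewrite KmxK -scalemxAr -scalemxAl scalerA.
(* The scalar v^t v equals N and cancels one of the two factors 1/N. *)
suff -> : \sum_a \sum_b (1%:M : 'M[C]_(N * N)) (ij a a) (ij b b) = N%:R.
  by rewrite mulVf// scale1r.
rewrite -[N in N%:R]card_ord -sumr_const; apply: eq_bigr => a _.
rewrite (bigD1 a)//= big1 ?addr0 => [|b /negPf ba]; first by rewrite mxE eqxx.
by rewrite mxE (can_eq (@mxtens_indexK N N)) xpair_eqE eq_sym ba.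
Qed.

(** M = Q M Q, and the two rank-one factors leave a number between them. *)
Lemma Qmx_rank1 (M : 'M[C]_(N * N)) :
  Qmx V *m M = M -> M *m Qmx V = M -> exists d, M = d *: Qmx V.
Proof.
move=> QM MQ.
pose d := \sum_a \sum_b (V1 *m M *m V1) (ij a a) (ij b b).
have E : V1 *m (Kmx C N *m (V1 *m M *m V1) *m Kmx C N) *m V1 =
    d *: (V1 *m Kmx C N *m V1).
  by rewrite KmxK -scalemxAr -scalemxAl.
exists (N%:R^-1 * d); rewrite -[LHS]QM -[in LHS]MQ /Qmx -/(Kmx C N).
rewrite -!scalemxAl -!scalemxAr [RHS]scalerA mulrAC -!scalerA; congr (_ *: (_ *: _)).
by rewrite -E !mulmxA.
Qed.

Hypotheses (q0 : q != 0) (q2 : q ^+ 2 != 1).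
Variables K Kb : int -> 'M[C]_N.
Hypotheses (lK : laurent K) (lKb : laurent Kb).
Hypothesis KbK : refl_eq (Rbar q rho V) Kb K.
Local Notation Q := (cst (Qmx V)).
Local Notation VV := (cst (V1 *m V2)).
Local Notation R12 := (subst (A := C^o) rho (2 : int) (Rbar q rho V)).
Local Notation R21 := (subst (A := C^o) rho (2 : int) (swap (Rbar q rho V))).
Local Notation K2 := (sp2 (subst (A := C^o) rho (1 : int) K)).

Lemma laurent_Rbar : laurent (Rbar q rho V).
Proof.
exists (-1) => k km; apply: contrapT => /Rbar_support; lia.
Qed.

Lemma laurent_R12 : laurent R12.
Proof. by apply: (@subst_laurent _ C^o) => //; exact: laurent_Rbar. Qed.

Lemma laurent_R21 : laurent R21.
Proof.
by apply: (@subst_laurent _ C^o) => //; apply: laurent_swap; exact: laurent_Rbar.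
Qed.

Lemma laurent_K2 : laurent K2.
Proof. by apply: laurent_sp2; exact: (@subst_laurent _ C^o). Qed.

Lemma K_contraction :
  Q ** sp1 Kb ** R21 ** K2 ** VV = K2 ** R12 ** sp1 Kb ** VV ** Q.
Proof.
have [l12 l21 l2] := And3 laurent_R12 laurent_R21 laurent_K2.
have := refl_eq_specialized rho0 lKb lK (@Rbar_support) KbK.
rewrite sum_Rbar sum_swap_Rbar; set c := (_ * _).
have c0 : c != 0.
  rewrite mulf_neq0// subr_eq0; apply: contraNneq q2 => E.
  by rewrite expr2 {2}E mulfV.
move=> H.
(* Both constants of the specialized equation carry the factor (q - q^-1) N, nonzero by [c0], which
   is cancelled here. *)
have cQ : Q ** sp1 Kb ** R21 ** K2 =
    K2 ** R12 ** sp1 Kb ** cst (P *m Qmx V *m P).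
  have csl (M : 'M[C]_(N * N)) X : cst (c *: M) ** X = fun k => c *: (cst M ** X) k.
    by apply/funext => k; rewrite !cst_smulE scalemxAl.
  have csr (M : 'M[C]_(N * N)) X : X ** cst (c *: M) = fun k => c *: (X ** cst M) k.
    by apply/funext => k; rewrite !smul_cstE scalemxAr.
  move: H; rewrite csr -!smulA// csl => H; rewrite !smulA//.
  apply/funext => k; apply: (scalerI c0).
  by have := congr1 (fun F => F k) H; rewrite /= !smulA.
have lX : laurent (K2 ** R12 ** sp1 Kb) by laur.
rewrite cQ; move: (K2 ** R12 ** sp1 Kb) lX => X lX.
by rewrite -[LHS]smulA// -[RHS]smulA// !cstM Qmx_swap.
Qed.

(** One form of the contraction begins with Q and the other ends with Q, so every coefficient is
    fixed by Q on both sides. *)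
Lemma K_contraction_scalar : exists d : int -> C, forall k,
  (Q ** sp1 Kb ** R21 ** K2 ** VV) k = d k *: Qmx V.
Proof.
have [l12 l21 l2] := And3 laurent_R12 laurent_R21 laurent_K2.
suff H : forall k, exists d, (Q ** sp1 Kb ** R21 ** K2 ** VV) k = d *: Qmx V.
  by have [d dE] := choice H; exists d.
have E : Q ** sp1 Kb ** R21 ** K2 ** VV = Q ** (sp1 Kb ** R21 ** K2 ** VV).
  by rewrite -!smulA.
move=> k; apply: Qmx_rank1; first by rewrite E cst_smulE mulmxA QmxK.
by rewrite K_contraction smul_cstE -mulmxA QmxK.
Qed.

End SpectralRMatrix.

(** * Factorization of the contraction *)

Section Swap.
Variables (S : pzRingType) (N : nat).
Implicit Types (X : int -> 'M[S]_N) (Z : int -> 'M[S]_(N * N)).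

Lemma swap_smul Z Z' : laurent Z -> laurent Z' ->
  swap (Z ** Z') = swap Z ** swap Z'.
Proof.
move=> lZ lZ'; pose p := cst (Pmx S N) : int -> _.
have swapE Z0 : swap Z0 = p ** Z0 ** p.
  by apply/funext => k; rewrite smul_cstE cst_smulE.
have lp : laurent p by exact: laurent_cst.
have pp : p ** p = cst 1%:M by rewrite cstM PmxK.
by rewrite !swapE -!smulA// (smulL1 pp)// smul1s.
Qed.

Lemma swap_sp1 X : swap (sp1 X) = sp2 X.
Proof.
by apply/funext => k; rewrite /swap Pmx_mx1 -mulmxA PmxK mulmx1.
Qed.

Lemma swap_sp2 X : swap (sp2 X) = sp1 X.
Proof.
by apply/funext => k; rewrite /swap Pmx_mx2 -mulmxA PmxK mulmx1.
Qed.

Lemma swapK Z : swap (swap Z) = Z.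
Proof.
apply/funext => k; rewrite /swap -!mulmxA PmxK mulmx1 mulmxA.
by rewrite PmxK mul1mx.
Qed.

End Swap.

Section Contraction.
Variables (C : fieldType) (A : algType C) (N : nat) (q rho : C) (V : 'M[C]_N).
Hypotheses (rho0 : rho != 0) (VV1 : V *m V = 1%:M).
Hypothesis Vrev : forall a b, b != rev_ord a -> V a b = 0.
Hypotheses (N0 : N%:R != 0 :> C) (q0 : q != 0) (q2 : q ^+ 2 != 1).
Local Notation U := (map_mx (in_alg A) V).
Local Notation Ut := (map_mx (in_alg A) V^T).

Variables T Ti M Mi : int -> 'M[A]_N.
Hypotheses (lT : laurent T) (lM : laurent M).
Hypotheses (TTi : is_sinv T Ti) (MMi : is_sinv M Mi).
Local Notation w := (emb A (swap (Rtwist N q rho))).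
Hypothesis TMw : sp1 T ** sp2 M ** w = w ** sp2 M ** sp1 T.

(** Here [T] stands for T^+(z rho) and [M] for T^-(z^-1 rho^-1). [That1] and [Mhat1] are the outer
    factors of Bbar_1(z). *)
Definition That1 := sp1 (cst U ** str Ti ** cst U).
Definition Mhat1 := sp1 (cst Ut ** str M ** cst Ut).
Definition R12A := emb A (subst (A := C^o) rho (2 : int) (Rbar q rho V)).
Definition R21A := emb A (subst (A := C^o) rho (2 : int) (swap (Rbar q rho V))).
Definition QA : int -> 'M[A]_(N * N) := emb A (cst (Qmx V)).
Definition VVA : int -> 'M[A]_(N * N) := emb A (cst (mx1 V *m mx2 V)).

Lemma laurent_Rtwist : laurent (Rtwist N q rho).
Proof.
have l : laurent (swap (Rtwist N q rho)).
  rewrite /Rtwist (@swap_subst _ C^o)//; apply: (@subst_laurent _ C^o) => //.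
  exact: laurent_swap_Rsqinv.
by rewrite -[Rtwist _ _ _]swapK; exact: laurent_swap.
Qed.

Lemma laurent_Ti : laurent Ti. Proof. by case: TTi. Qed.
Lemma laurent_Mi : laurent Mi. Proof. by case: MMi. Qed.

Lemma map_VK : U *m U = 1%:M.
Proof. by rewrite -map_mxM VV1 map_mx1. Qed.

Lemma map_VtK : Ut *m Ut = 1%:M.
Proof. by rewrite -map_mxM -trmx_mul VV1 trmx1 map_mx1. Qed.

Lemma emb_tr1 (Z : int -> 'M[C]_(N * N)) : emb A (tr1 Z) = tr1 (emb A Z).
Proof. by apply/funext => k; exact: map_ptrmx1. Qed.

Lemma R12AE : R12A = cst (mx1 U) ** tr1 w ** cst (mx1 U).
Proof.
rewrite /R12A subst_RbarE// -emb_tr1 -map_leg1 -emb_cst.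
have lw := laurent_Rtwist.
rewrite -!emb_smul//; congr emb; apply/funext => k.
by rewrite smul_cstE cst_smulE Rbar12.
Qed.

(** The conjugating matrices match those of the letters to be exchanged: V in [R12A] and [That1],
    V^t in [R21A] and [Mhat1]. *)
Lemma R21AE : R21A = cst (mx1 Ut) ** tr1 (emb A (Rtwist N q rho)) ** cst (mx1 Ut).
Proof.
rewrite /R21A swap_subst_RbarE// -emb_tr1 -map_leg1 -emb_cst.
have lw := laurent_Rtwist.
rewrite -!emb_smul//; congr emb; apply/funext => k.
by rewrite smul_cstE cst_smulE Rbar21.
Qed.

Lemma exchange_That_Mi : That1 ** R12A ** sp2 Mi = sp2 Mi ** R12A ** That1.
Proof.
have [lTi lMi lw] := And3 laurent_Ti laurent_Mi laurent_Rtwist.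
have lW : laurent w by [].
rewrite R12AE; apply: exchange_conj => //; first exact: central_alg.
  exact: map_VK.
apply: exchange_tr1 => //; first by move=> k; exact: central_alg.
have T1 : sp1 T ** sp1 Ti = cst 1%:M.
  by case: TTi => _ E _; rewrite -sp1_smul// E sp1_cst mx1_1.
have T2 : sp1 Ti ** sp1 T = cst 1%:M.
  by case: TTi => _ _ E; rewrite -sp1_smul// E sp1_cst mx1_1.
have M1 : sp2 M ** sp2 Mi = cst 1%:M.
  by case: MMi => _ E _; rewrite -sp2_smul// E sp2_cst mx2_1.
have M2 : sp2 Mi ** sp2 M = cst 1%:M.
  by case: MMi => _ _ E; rewrite -sp2_smul// E sp2_cst mx2_1.
(* Multiplying [TMw] by the inverses on both sides yields the relation for Ti_1 and Mi_2 to which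
   [exchange_tr1] applies. *)
transitivity (sp2 Mi ** sp1 Ti ** (sp1 T ** sp2 M ** w) ** (sp1 Ti ** sp2 Mi)).
  rewrite -!smulA// (smulL1 T2)// smul1s (smulL1 M2)// smul1s.
  by rewrite smulA.
rewrite TMw -!smulA// (smulL1 T1)// smul1s M1 smuls1.
by rewrite smulA.
Qed.

(** Exchanging the two legs in [TMw] places [M] on leg 1 and [T] on leg 2, with R_12 instead of
    R_21; then leg 1 is transposed and conjugated by V^t. *)
Lemma exchange_Mhat_T : Mhat1 ** R21A ** sp2 T = sp2 T ** R21A ** Mhat1.
Proof.
have lR := laurent_Rtwist.
have lW : laurent w by [].
rewrite R21AE; apply: exchange_conj => //; first exact: central_alg.
  exact: map_VtK.
apply: exchange_tr1 => //; first by move=> k; exact: central_alg.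
have := congr1 (@swap A N) TMw.
rewrite !swap_smul// !swap_sp1 !swap_sp2 -emb_swap swapK => E.
by rewrite -E.
Qed.

Local Notation kap := (cst (Kmx A N) : int -> 'M[A]_(N * N)).
Local Notation u1 := (cst (mx1 U) : int -> 'M[A]_(N * N)).
Local Notation u2 := (cst (mx2 U) : int -> 'M[A]_(N * N)).
Local Notation ut := (cst (mx1 Ut) : int -> 'M[A]_(N * N)).
Local Notation cl := (cst ((N%:R^-1)%:A *: mx1 U) : int -> 'M[A]_(N * N)).

Lemma map_Qmx : map_mx (in_alg A) (Qmx V) =
  (N%:R^-1)%:A *: (mx1 U *m Kmx A N *m mx1 U).
Proof. by rewrite /Qmx map_mxZ !map_mxM map_leg1 -/(Kmx C N) map_Kmx. Qed.

(** The factor 1/N is put on the V_1 away from the letters being absorbed, so that the V_1 facing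
    them cancels exactly. *)
Lemma QA_l : QA = cl ** kap ** u1.
Proof. by rewrite /QA emb_cst map_Qmx !cstM -!scalemxAl. Qed.

Lemma QA_r : QA = u1 ** kap ** cl.
Proof. by rewrite /QA emb_cst map_Qmx !cstM mulmx_algr. Qed.

Lemma VVA_E : VVA = u1 ** u2.
Proof. by rewrite /VVA emb_cst cstM map_mxM map_leg1 map_leg2. Qed.

Lemma u1u1 : u1 ** u1 = cst 1%:M.
Proof. by rewrite cstM -mx1M map_VK mx1_1. Qed.

Lemma u2u2 : u2 ** u2 = cst 1%:M.
Proof. by rewrite cstM -mx2M map_VK mx2_1. Qed.

Lemma utut : ut ** ut = cst 1%:M.
Proof. by rewrite cstM -mx1M map_VtK mx1_1. Qed.

Lemma sp2_central (X : int -> 'M[A]_N) (W : 'M[C]_N) :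
  cst (mx1 (map_mx (in_alg A) W)) ** sp2 X =
  sp2 X ** cst (mx1 (map_mx (in_alg A) W)).
Proof.
rewrite -sp1_cst; apply: sp12C => h l; apply: central_comm.
rewrite /cst; case: ifP => _; first exact: central_alg.
by move=> i j a; rewrite mxE; exact/commr_sym/commr0.
Qed.

Lemma u1u2 : u1 ** u2 = u2 ** u1.
Proof. by rewrite -[u2]sp2_cst sp2_central. Qed.

Lemma kap_l (X : int -> 'M[A]_N) : kap ** sp1 (str X) = kap ** sp2 X.
Proof. by apply/funext => k; rewrite !cst_smulE; exact: Kmx_mx1. Qed.

Lemma kap_r (X : int -> 'M[A]_N) : sp1 (str X) ** kap = sp2 X ** kap.
Proof. by apply/funext => k; rewrite !smul_cstE; exact: mx1_Kmx. Qed.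

Lemma kap_u2 : kap ** u2 = kap ** ut.
Proof. by rewrite !cstM -map_trmx Kmx_mx1. Qed.

Lemma u2_kap : u2 ** kap = ut ** kap.
Proof. by rewrite !cstM -map_trmx mx1_Kmx. Qed.

Lemma That1E : That1 = u1 ** sp1 (str Ti) ** u1.
Proof. by have lTi := laurent_Ti; rewrite /That1 !sp1_smul// sp1_cst. Qed.

Lemma Mhat1E : Mhat1 = ut ** sp1 (str M) ** ut.
Proof. by rewrite /Mhat1 !sp1_smul// sp1_cst. Qed.

Lemma laurent_That1 : laurent That1.
Proof. by have lTi := laurent_Ti; rewrite That1E. Qed.

Lemma laurent_Mhat1 : laurent Mhat1.
Proof. by rewrite Mhat1E. Qed.

(** After the cancellation of V_1, P^{t_2} converts the transposed inverse on leg 1 into Ti_2, which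
    meets T_2. *)
Lemma QA_That_T : QA ** That1 ** sp2 T = QA.
Proof.
have lTi := laurent_Ti.
have T2 : sp2 Ti ** sp2 T = cst 1%:M.
  by case: TTi => _ _ E; rewrite -sp2_smul// E sp2_cst mx2_1.
rewrite QA_l That1E -!smulA// (smulL1 u1u1)// smul1s sp2_central.
by rewrite (smulL (kap_l Ti))// (smulL1 T2)// smul1s.
Qed.

Lemma T_That_QA : sp2 T ** That1 ** QA = QA.
Proof.
have lTi := laurent_Ti.
have T1 : sp2 T ** sp2 Ti = cst 1%:M.
  by case: TTi => _ E _; rewrite -sp2_smul// E sp2_cst mx2_1.
rewrite QA_r That1E -!smulA// (smulL1 u1u1)// smul1s (smulL (kap_r Ti))//.
by rewrite -(smulL (sp2_central T V))// (smulL1 T1)// smul1s.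
Qed.

(** Q V_1 V_2 ends in P^{t_2} V_2 = P^{t_2} V_1^t, and this V^t cancels the first one of [Mhat1];
    the final V_1 V_2 restores Q. *)
Lemma QA_Mhat_Mi : QA ** VVA ** Mhat1 ** sp2 Mi ** VVA = QA.
Proof.
have lMi := laurent_Mi.
have M1 : sp2 M ** sp2 Mi = cst 1%:M.
  by case: MMi => _ E _; rewrite -sp2_smul// E sp2_cst mx2_1.
rewrite QA_l VVA_E Mhat1E -!smulA// (smulL1 u1u1)// smul1s.
rewrite (smulL kap_u2)// (smulL1 utut)// smul1s (smulL (sp2_central Mi V^T))//.
rewrite (smulL (kap_l M))// (smulL1 M1)// smul1s -(smulL kap_u2)//.
by rewrite u1u2 (smulL1 u2u2)// smul1s.
Qed.

Lemma Mi_Mhat_QA : sp2 Mi ** Mhat1 ** VVA ** QA = VVA ** QA.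
Proof.
have lMi := laurent_Mi.
have M2 : sp2 Mi ** sp2 M = cst 1%:M.
  by case: MMi => _ _ E; rewrite -sp2_smul// E sp2_cst mx2_1.
have VVQ : VVA ** QA = ut ** (kap ** cl).
  rewrite QA_r VVA_E u1u2 -!smulA// (smulL1 u1u1)// smul1s.
  by rewrite (smulL u2_kap).
have lVV : laurent VVA by rewrite VVA_E.
have lQ : laurent QA by rewrite QA_l.
have lMh := laurent_Mhat1.
rewrite -smulA// VVQ Mhat1E -!smulA// (smulL1 utut)// smul1s (smulL (kap_r M))//.
by rewrite -(smulL (sp2_central Mi V^T))// (smulL1 M2)// smul1s.
Qed.

Lemma VVA_VVA : VVA ** VVA = cst 1%:M.
Proof. by rewrite VVA_E -!smulA// u1u2 (smulL1 u2u2)// smul1s u1u1. Qed.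

Lemma QA_QA : QA ** QA = QA.
Proof. by rewrite /QA -emb_smul// cstM QmxK. Qed.

Variables K Kb : int -> 'M[C]_N.
Hypotheses (lK : laurent K) (lKb : laurent Kb).
Hypothesis KbK : refl_eq (Rbar q rho V) Kb K.

Lemma contraction_scalar : exists d : int -> C,
  QA ** (That1 ** sp1 (emb A Kb) ** Mhat1) ** R21A
    ** (sp2 T ** sp2 (subst rho (1 : int) (emb A K)) ** sp2 Mi) ** VVA =
    (fun k => (d k)%:A *: map_mx (in_alg A) (Qmx V)) /\
  sp2 T ** sp2 (subst rho (1 : int) (emb A K)) ** sp2 Mi ** R12A
    ** (That1 ** sp1 (emb A Kb) ** Mhat1) ** VVA ** QA =
    (fun k => (d k)%:A *: map_mx (in_alg A) (Qmx V)).
Proof.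
have [lTi lMi lTh] := And3 laurent_Ti laurent_Mi laurent_That1.
have lMh := laurent_Mhat1.
have l12 : laurent (subst (A := C^o) rho (2 : int) (Rbar q rho V)).
  exact: laurent_R12.
have l21 : laurent (subst (A := C^o) rho (2 : int) (swap (Rbar q rho V))).
  exact: laurent_R21.
have l2 : laurent (sp2 (subst (A := C^o) rho (1 : int) K)) by exact: laurent_K2.
have lQ : laurent QA by rewrite QA_l.
have lVV : laurent VVA by rewrite VVA_E.
have lR12 : laurent R12A by exact: laurent_emb.
have lR21 : laurent R21A by exact: laurent_emb.
have [d dE] := K_contraction_scalar rho0 VV1 N0 q0 q2 lK lKb KbK.
pose Y := fun k => (d k)%:A *: map_mx (in_alg A) (Qmx V).
have dY : emb A (fun k => d k *: Qmx V) = Y.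
  by apply/funext => k; rewrite /emb map_mxZ.
have K2E : sp2 (subst rho (1 : int) (emb A K)) =
    emb A (sp2 (subst (A := C^o) rho (1 : int) K)).
  by rewrite emb_sp2 emb_subst//; exact: mulrz_intI.
have KbE : sp1 (emb A Kb) = emb A (sp1 Kb) by rewrite emb_sp1.
(* The scalar matrices K and Kbar have central entries in [A], so they commute with every letter on
   the other leg. *)
have cK (X : int -> 'M[C]_N) (Z : int -> 'M[A]_N) :
    sp1 (emb A X) ** sp2 Z = sp2 Z ** sp1 (emb A X).
  by apply: sp12C => h l; apply: central_comm; exact: central_alg.
have cK' (X : int -> 'M[C]_N) (Z : int -> 'M[A]_N) :
    sp1 Z ** sp2 (emb A X) = sp2 (emb A X) ** sp1 Z.
  by apply: sp12C => h l; apply: comm_central; exact: central_alg.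
exists d; rewrite -/Y.
have lK2 : laurent (sp2 (subst rho (1 : int) (emb A K))) by rewrite K2E.
apply: contraction_chain => //.
- exact: exchange_Mhat_T.
- exact: exchange_That_Mi.
- by rewrite -emb_subst; [exact: cK' | exact: mulrz_intI].
- by rewrite -emb_subst; [exact: cK' | exact: mulrz_intI].
- exact: QA_That_T.
- exact: QA_Mhat_Mi.
- exact: Mi_Mhat_QA.
- exact: T_That_QA.
- rewrite -dY -(funext dE) K2E KbE /QA /VVA /R21A !emb_smul//.
- rewrite -dY -(funext dE) (K_contraction rho0 VV1 N0 q0 q2 lK lKb KbK).
  by rewrite K2E KbE /QA /VVA /R12A !emb_smul.
- exact: VVA_VVA.
- exact: QA_QA.
Qed.

End Contraction.

(** * The two choices of V *)

Section Antidiagonal.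
Variables (C : fieldType) (N : nat).

Lemma antidiagonalK (V : 'M[C]_N) :
  (forall a b, b != rev_ord a -> V a b = 0) ->
  (forall a, V a (rev_ord a) * V (rev_ord a) a = 1) -> V *m V = 1%:M.
Proof.
move=> Vrev VV; apply/matrixP => a b; rewrite !mxE (bigD1 (rev_ord a))//= big1.
  have [<-|ab] := eqVneq a b; first by rewrite addr0 VV.
  by rewrite [V (rev_ord a) b]Vrev ?mulr0 ?addr0// rev_ordK eq_sym.
by move=> k ka; rewrite Vrev ?mul0r.
Qed.

Lemma V_plus_antidiagonal (s : C) a b : b != rev_ord a -> V_plus N s a b = 0.
Proof. by rewrite mxE => /negPf ->. Qed.

Lemma V_plusK (s : C) : s != 0 -> V_plus N s *m V_plus N s = 1%:M.
Proof.
move=> s0; apply: antidiagonalK; first exact: V_plus_antidiagonal.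
move=> a; rewrite !mxE rev_ordK !eqxx -expfzDr//.
by rewrite [X in _ ^ X](_ : _ = 0) ?expr0z//; lia.
Qed.

End Antidiagonal.

Section VMinus.
Variables (R : realType) (N : nat) (s : R[i]).

Lemma V_minus_antidiagonal a b : b != rev_ord a -> V_minus N s a b = 0.
Proof. by rewrite mxE => /negPf ->. Qed.

Lemma V_minusK : s != 0 -> ~~ odd N -> V_minus N s *m V_minus N s = 1%:M.
Proof.
move=> s0 oddN; apply: antidiagonalK; first exact: V_minus_antidiagonal.
move=> a; rewrite !mxE rev_ordK !eqxx mulrACA -expfzDr//.
rewrite [X in _ ^ X](_ : _ = 0) ?expr0z ?mulr1; last by lia.
rewrite mulrACA -exprD -expr2 sqr_i -signr_odd.
(* The shifted indices of [a] and [rev_ord a] add up to N + 1, so for even N the sign is -1 and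
   cancels the square of the imaginary unit. *)
suff -> : odd (a.+1 + (rev_ord a).+1) by rewrite expr1 mulrNN mulr1.
have -> : (a.+1 + (rev_ord a).+1 = N.+1)%N by rewrite /=; have := ltn_ord a; lia.
by rewrite /= oddN.
Qed.

End VMinus.

(** * Monodromy matrices of the copies of the quantum algebra *)

Section Transfer.
Variables (C : fieldType) (A : algType C) (N m : nat) (q : C).
Variables Lp Lm : 'I_m -> nat -> 'M[A]_N.
Hypothesis hL : Uq_copies q Lp Lm.

Lemma laurent_Tser (L : 'I_m -> nat -> 'M[A]_N) : laurent (Tser 1 L).
Proof. by apply: laurent_prod => i; exact: laurent_Lser1. Qed.

Lemma Tser_invertible (L : 'I_m -> nat -> 'M[A]_N) :
  (forall i, exists U, two_sided (L i 0%N) U) -> exists Y, is_sinv (Tser 1 L) Y.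
Proof.
move=> LU; suff [] : laurent (Tser 1 L) /\ exists Y, is_sinv (Tser 1 L) Y by [].
apply: (@big_smul_ind _ _ _ _ _ (fun X => laurent X /\ exists Y, is_sinv X Y))
  => [|X X' [lX [Y XY]] [lX' [Y' XY']]|i].
- by split; [exact: laurent_cst | exists (cst 1%:M); exact: is_sinv_one].
- by split; [exact: laurent_smul | exists (Y' ** Y); exact: is_sinv_smul].
split; first exact: laurent_Lser1.
have [U LiU] := LU i; apply: (@is_sinv_of_const _ _ _ U).
  by move=> k; exact: Lser1_neg.
by rewrite Lser1_0.
Qed.

(** The constant coefficient of each L^+ is lower triangular, and its diagonal is inverted by that
    of L^-. For L^- the roles are reversed. *)
Lemma Tplus_invertible : exists Y, is_sinv (Tser 1 Lp) Y.
Proof.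
apply: Tser_invertible => i; have [/(_ i) [_ _ _ tri diag] _] := hL.
apply: lower_triangular_inv => [a b /tri[]//|a].
by exists (Lm i 0%N a a); exact: diag.
Qed.

Lemma Tminus_invertible : exists Y, is_sinv (Tser 1 Lm) Y.
Proof.
apply: Tser_invertible => i; have [/(_ i) [_ _ _ tri diag] _] := hL.
apply: upper_triangular_inv => [a b /tri[]//|a].
by exists (Lp i 0%N a a); have [] := diag a.
Qed.

Lemma RTT_Tser : emb A (Rsq N q) ** sp1 (Tser 1 Lp) ** sp2 (Tser 1 Lm) =
  sp2 (Tser 1 Lm) ** sp1 (Tser 1 Lp) ** emb A (Rsq N q).
Proof.
have [hU hC] := hL.
apply: RTT_prod => [i|i||i|i j ij|]; try exact: laurent_Lser1.
- by apply: laurent_emb; exact: laurent_Rsq.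
- by apply: RLL_one_variable; have [] := hU i.
- by apply: comm_Lser1 => p p'; have [] := hC _ _ ij p p'.
- exact: index_enum_uniq.
Qed.

(** The exchange relation is inverted in the variable z, and only then is z replaced by z rho; this
    substitution respects products of Laurent series. *)
Lemma RTT_twisted (rho : C) : rho != 0 -> q != 0 ->
  let T := subst rho (1 : int) (Tser 1 Lp) in
  let M := subst rho (1 : int) (Tser 1 Lm) in
  let w := emb A (swap (Rtwist N q rho)) in
  sp1 T ** sp2 M ** w = w ** sp2 M ** sp1 T.
Proof.
move=> rho0 q0 /=.
have inj1 := @mulrz_intI 1 isT.
have [lT lM] := (laurent_Tser Lp, laurent_Tser Lm).
have lw := laurent_swap_Rsqinv N q.
have lr := laurent_Rsq N q.
have -> : emb A (swap (Rtwist N q rho)) =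
    subst rho (1 : int) (emb A (swap (Rsqinv N q))).
  by rewrite /Rtwist (@swap_subst _ C^o)// emb_subst.
rewrite sp1_subst// sp2_subst//.
rewrite -!subst1_smul//; congr subst.
rewrite (@exchange_Rsqinv _ _ _ q0 _ _ (sp2 (Tser 1 Lm) ** sp1 (Tser 1 Lp)))//.
  by rewrite smulA.
by rewrite smulA// RTT_Tser.
Qed.

End Transfer.

(** A nonzero entry of Q allows [d] to be read off from the product of Q with [d], which gives
    uniqueness of the contraction. *)
Lemma Qmx_neq0 (C : fieldType) (N : nat) (V : 'M[C]_N) :
  N%:R != 0 :> C -> V *m V = 1%:M -> exists i j, Qmx V i j != 0.
Proof.
move=> N0 VV1; apply: contrapT => nQ.
have Q0 : Qmx V = 0.
  apply/matrixP => i j; rewrite [RHS]mxE; apply: contrapT => /eqP Qij.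
  by apply: nQ; exists i, j.
have K0 : Kmx C N = 0.
  have := congr1 (fun M => N%:R *: (mx1 V *m M *m mx1 V)) Q0.
  rewrite /Qmx -/(Kmx C N) mulmx0 mul0mx scaler0 -scalemxAr -scalemxAl scalerA.
  rewrite mulfV// scale1r !mulmxA V1V1// mul1mx -!mulmxA.
  by rewrite V1V1// mulmx1.
case: N V N0 {VV1 nQ Q0} K0 => [|n] V N0 K0; first by rewrite eqxx in N0.
have := congr1 (fun M : 'M[C]_(n.+1 * n.+1) => M (ij ord0 ord0) (ij ord0 ord0)) K0.
by rewrite /= KmxE !eqxx mxE => /eqP; rewrite oner_eq0.
Qed.

(** Membership in the algebra is part of [center]; a unital subalgebra contains all scalars, zero
    being obtained as -1 times 1 plus 1. *)
Lemma refl_alg_scalar (C : fieldType) (A : algType C) N (B : int -> 'M[A]_N) (c : C) :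
  refl_alg B c%:A.
Proof.
move=> S [[S1 Slin _] _]; have S0 : 0 \in [in S].
  by rewrite -(addNr (1 : A)) -scaleN1r; exact: Slin.
by have := Slin c 1 0 S1 S0; rewrite addr0 !inE.
Qed.

(** * Existence, uniqueness and centrality of the contraction *)

Section QuantumContraction.
Variables (C : fieldType) (A : algType C) (N m : nat) (q rho : C) (V : 'M[C]_N).
Hypotheses (rho0 : rho != 0) (VV1 : V *m V = 1%:M).
Hypothesis Vrev : forall a b, b != rev_ord a -> V a b = 0.
Hypotheses (N0 : N%:R != 0 :> C) (q0 : q != 0) (q2 : q ^+ 2 != 1).
Variables Lp Lm : 'I_m -> nat -> 'M[A]_N.
Hypothesis hL : Uq_copies q Lp Lm.
Variables K Kb : int -> 'M[C]_N.
Hypotheses (lK : laurent K) (lKb : laurent Kb).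
Hypothesis KbK : refl_eq (Rbar q rho V) Kb K.
Local Notation Tp := (Tser 1 Lp).
Local Notation Tm := (Tser (-1) Lm).
Local Notation B := (Bser K Tp Tm).
Local Notation Bb := (Bbar rho V Kb Tp Tm).

Lemma is_contraction_scalar :
  exists c : int -> C, is_contraction q rho V Bb B (fun k => (c k)%:A).
Proof.
have inj1 := @mulrz_intI 1 isT.
pose T : int -> 'M[A]_N := subst rho (1 : int) Tp.
pose M : int -> 'M[A]_N := subst rho (1 : int) (Tser 1 Lm).
have lT0 := laurent_Tser Lp; have lM0 := laurent_Tser Lm.
have lT : laurent T by rewrite /T; laur.
have lM : laurent M by rewrite /M; laur.
have sinv_subst (X Y : int -> 'M[A]_N) : laurent X -> is_sinv X Y ->
    is_sinv (subst rho (1 : int) X) (subst rho (1 : int) Y).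
  move=> lX [lY XY YX]; split; first by apply: subst_laurent.
    by rewrite -subst1_smul// XY subst_cst.
  by rewrite -subst1_smul// YX subst_cst.
have [Y TpY] := Tplus_invertible hL.
(* In Bbar(z) the inverse is taken after the substitution z -> z rho, in B(z rho) before it. So the
   inverse of [T] is its own [sinv], while that of [M] is a substituted one. *)
have TTi : is_sinv T (sinv T).
  by apply: sinvP; exists (subst rho (1 : int) Y); exact: sinv_subst.
have M0Mi := sinvP (Tminus_invertible hL).
have MMi : is_sinv M (subst rho (1 : int) (sinv (Tser 1 Lm))).
  exact: sinv_subst.
have [c [E1 E2]] := contraction_scalar rho0 VV1 Vrev N0 q0 q2 lT lM TTi MMi
  (RTT_twisted hL rho0 q0) lK lKb KbK.
have lMi0 : laurent (sinv (Tser 1 Lm)) by case: M0Mi.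
have [lTi lMi] : laurent (sinv T) /\ laurent (subst rho (1 : int) (sinv (Tser 1 Lm))).
  by case: TTi; case: MMi.
have B2E : sp2 (subst rho (1 : int) B) = sp2 T
    ** sp2 (subst rho (1 : int) (emb A K))
    ** sp2 (subst rho (1 : int) (sinv (Tser 1 Lm))).
  by rewrite /Bser Tser_opp !subst1_smul// !sp2_smul.
pose U := map_mx (in_alg A) V; pose Ut := map_mx (in_alg A) V^T.
(* T^-(z^-1 rho^-1) is the power series T^-(1/z) with z replaced by z rho. *)
have ME : subst rho^-1 (- 1 : int) Tm = M.
  by rewrite /M -Tser_opp subst1_subst ?oner_neq0// mulr1 exprN1.
have VE : emb A (cst V) = cst U :> (int -> _) by exact: emb_cst.
have VtE : emb A (cst V^T) = cst Ut :> (int -> _) by exact: emb_cst.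
have BbE : sp1 Bb = That1 V (sinv T) ** sp1 (emb A Kb) ** Mhat1 V M.
  rewrite /That1 /Mhat1 -!sp1_smul//; congr sp1.
  have -> : Bb = cst U ** str (sinv T) ** cst U ** emb A Kb ** cst Ut ** str M
      ** cst Ut.
    by rewrite -ME -VE -VtE.
  by rewrite -!smulA.
exists c; rewrite /is_contraction B2E BbE.
by split; [exact: E1 | exact: E2].
Qed.

Lemma is_contraction_inj d d' :
  is_contraction q rho V Bb B d -> is_contraction q rho V Bb B d' -> d = d'.
Proof.
move=> [E _] [E' _]; apply/funext => k.
have [i [j Qij]] := Qmx_neq0 N0 VV1.
have := congr1 (fun F : int -> 'M[A]_(N * N) => F k i j) (etrans (esym E) E').
move: (Qmx V) Qij => Qm Qij; rewrite !mxE /= !mulr_algr.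
exact: scalerI.
Qed.

Lemma quantum_contraction_central :
  (exists! d : int -> A, is_contraction q rho V Bb B d) /\
  (forall d : int -> A, is_contraction q rho V Bb B d ->
     forall k : int, center (refl_alg B) (d k)).
Proof.
have [c cE] := is_contraction_scalar; split.
  by exists (fun k => (c k)%:A); split=> // d; exact: is_contraction_inj.
move=> d /(is_contraction_inj cE) <- k; split; first exact: refl_alg_scalar.
by move=> y _; rewrite /GRing.comm mulr_algl mulr_algr.
Qed.

End QuantumContraction.

Theorem propositionB2 (R : realType) (N : nat) (hN : (2 <= N)%N)
    (q s : R[i]) (hq0 : q != 0) (hq1 : q ^+ 2 != 1) (hs : s ^+ 2 = q)
    (V : 'M[R[i]]_N)
    (hV : V = V_plus N s \/ (~~ odd N /\ V = V_minus N s))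
    (A : algType R[i]) (m : nat) (hm : (1 <= m)%N)
    (Lp Lm : 'I_m -> nat -> 'M[A]_N) (hL : Uq_copies q Lp Lm)
    (K Kb : int -> 'M[R[i]]_N) (hK : laurent K) (hKb : laurent Kb)
    (hreflK : refl_eq (Rser N q) K K)
    (hreflKb : refl_eq (Rser N q) Kb Kb)
    (hreflKbK : refl_eq (Rbar q (s ^+ N) V) Kb K) :
  let rho := s ^+ N in
  let Tp := Tser 1 Lp in
  let Tm := Tser (-1) Lm in
  let B := Bser K Tp Tm in
  let Bb := Bbar rho V Kb Tp Tm in
  (exists! d : int -> A, is_contraction q rho V Bb B d) /\
  (forall d : int -> A, is_contraction q rho V Bb B d ->
     forall k : int, center (refl_alg B) (d k)).
Proof.
  move=> rho; have s0 : s != 0 by apply: contraNneq hq0 => s0; rewrite -hs s0 expr0n.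
  have rho0 : rho != 0 by rewrite expf_neq0.
  have N0 : N%:R != 0 :> R[i] by rewrite pnatr_eq0; lia.
  have [VV1 Vrev] : V *m V = 1%:M /\ forall a b, b != rev_ord a -> V a b = 0.
    case: hV => [->|[oddN ->]]; split.
    - exact: V_plusK.
    - exact: V_plus_antidiagonal.
    - exact: V_minusK.
    - exact: V_minus_antidiagonal.
  exact: quantum_contraction_central.
Qed.
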